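(* Let $\mu>0$ and $k_0,k_1\in\mathbb{R}$ be fixed. There exists a constant $C>0$, independent of $L\ge1$, such that for any $\mathbf{u}\in\mathcal{W}_L$, $$\|\nabla\mathbf{u}\|^2_{L^2(\Omega_L)}\le C\|\mathbf{u}\|_{L^2(\Omega_L)}\|\nabla\mathbf{u}\|_{H^1(\Omega_L)}.$$
   Context: For $L\ge1$, $\Omega_L:=(-L,L)\times(0,1)\subset\mathbb{R}^2$; $\mathbf{n}$ is the unit outer normal and $\tau$ a unit tangent vector on (the sides of) $\partial\Omega_L$; $\mathbb{D}(\mathbf{v})=\frac12(\nabla\mathbf{v}+\nabla^T\mathbf{v})$. The slip coefficient $k$ on $\partial\Omega_L$ is given by $k(x,1)=k_1$, $k(x,0)=k_0$, $k(-L,y)=k(L,y)=0$. Set $\mathbf{V}_L:=\{\mathbf{v}\in H^1(\Omega_L)^2:\nabla\cdot\mathbf{v}=0,\ \mathbf{v}\cdot\mathbf{n}=0\text{ on }\partial\Omega_L\}$ and $\mathcal{W}_L:=\{\mathbf{v}\in\mathbf{V}_L\cap H^2(\Omega_L)^2: 2\mu\mathbb{D}(\mathbf{v})\mathbf{n}\cdot\tau=k(x,y)\mathbf{v}\cdot\tau\text{ on }\partial\Omega_L\}$. *)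

(* Defs.v *)
From HB Require Import structures.
From mathcomp Require Import all_boot all_order all_algebra.
From mathcomp Require Import all_classical all_reals all_analysis.

Set Implicit Arguments.
Unset Strict Implicit.
Unset Printing Implicit Defensive.

Import Order.TTheory GRing.Theory Num.Theory.
Import numFieldNormedType.Exports.

Local Open Scope classical_set_scope.
Local Open Scope ring_scope.

Section Lebesgue2.
Context {d : measure_display} {T : measurableType d} {R : realType}.
Variable mu : {measure set T -> \bar R}.

(* Only the values of [f] on [D] matter. *)
Definition inL2 (D : set T) (f : T -> R) : Prop := (f \_ D) \in Lfun mu 2%:E.

(* Real-valued; meaningful for [f] satisfying [inL2 D f]. *)
Definition L2norm (D : set T) (f : T -> R) : R :=
  fine ('N[mu]_2%:E [EFin \o (f \_ D)])%E.

End Lebesgue2.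

Section Calculus.
Context {R : realType}.

(* The index 0 is the x-direction and 1 the y-direction. *)
Definition evec (i : 'I_2) : R * R := if i == ord0 then (1, 0) else (0, 1).

Definition vec2 (a b : R) (i : 'I_2) : R := if i == ord0 then a else b.

Definition pderiv (i : 'I_2) (f : R * R -> R) : R * R -> R :=
  fun p => 'D_(evec i) f p.

(* C^infinity on the plane: every iterated partial derivative is
   differentiable, hence continuous. *)
Definition smooth (f : R * R -> R) : Prop :=
  forall (s : seq 'I_2) (p : R * R), differentiable (foldr pderiv f s) p.

Definition leb1 : {measure set (measurableTypeR R) -> \bar R} :=
  @lebesgue_measure R.

Definition leb2 : {measure set (measurableTypeR R * measurableTypeR R) -> \bar R}
  := (@lebesgue_measure R \x @lebesgue_measure R)%E.

End Calculus.

Section Sobolev.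
Context {R : realType}.
Implicit Types (L : R) (f g : R * R -> R).

Definition Omega L : set (R * R) :=
  [set p | - L < p.1 < L /\ 0 < p.2 < 1].

Definition test_function L f : Prop :=
  [/\ smooth f, compact (closure [set p | f p != 0]) &
      closure [set p | f p != 0] `<=` Omega L].

Definition weak_partial L (i : 'I_2) f g : Prop :=
  forall phi, test_function L phi ->
    \int[leb2]_(p in Omega L) (f p * pderiv i phi p) =
    - \int[leb2]_(p in Omega L) (g p * phi p).

Definition L2_weak_partials L (i : 'I_2) f : set (R * R -> R) :=
  [set g | inL2 leb2 (Omega L) g /\ weak_partial L i f g].

(* A representative of the i-th weak derivative of [f]; it is the constant 0
   when [f] has no square-integrable weak derivative. *)
Definition wD L (i : 'I_2) f : R * R -> R :=
  xget (cst 0) (L2_weak_partials L i f).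

Definition H1 L f : Prop :=
  inL2 leb2 (Omega L) f /\ forall i, L2_weak_partials L i f !=set0.

Definition H2 L f : Prop := H1 L f /\ forall i, H1 L (wD L i f).

Definition H1norm L f : R :=
  Num.sqrt (L2norm leb2 (Omega L) f ^+ 2 +
            \sum_(i < 2) L2norm leb2 (Omega L) (wD L i f) ^+ 2).

End Sobolev.

Inductive side := Bottom | Top | Left | Right.

Section Slip.
Context {R : realType}.
Implicit Types (L : R) (u : 'I_2 -> R * R -> R).

Definition side_point L (s : side) (t : R) : R * R :=
  match s with
  | Bottom => (t, 0) | Top => (t, 1) | Left => (- L, t) | Right => (L, t)
  end.

(* The open parameter interval of each side; the corners are left out. *)
Definition side_dom L (s : side) : set R :=
  match s with
  | Bottom | Top => [set t | - L < t < L]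
  | Left | Right => [set t | 0 < t < 1]
  end.

Definition normal (s : side) : 'I_2 -> R :=
  match s with
  | Bottom => vec2 0 (-1) | Top => vec2 0 1
  | Left => vec2 (-1) 0 | Right => vec2 1 0
  end.

(* Counterclockwise; the slip condition does not depend on the orientation. *)
Definition tangent (s : side) : 'I_2 -> R :=
  match s with
  | Bottom => vec2 1 0 | Top => vec2 (-1) 0
  | Left => vec2 0 (-1) | Right => vec2 0 1
  end.

(* [g] is the trace of [f] on the boundary: the trace operator is the
   continuous extension to H^1 of the restriction of functions smooth up to
   the boundary, so [g] is the L^2 limit of the boundary values of some smooth
   functions converging to [f] in H^1. *)
Definition is_trace L (f : R * R -> R) (g : side -> R -> R) : Prop :=
  [/\ H1 L f, (forall s, inL2 leb1 (side_dom L s) (g s)) &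
   exists2 F : nat -> R * R -> R, (forall n, smooth (F n)) &
    [/\ (fun n => L2norm leb2 (Omega L) (fun p => F n p - f p)) @ \oo --> (0 : R),
        (forall i, (fun n => L2norm leb2 (Omega L)
           (fun p => pderiv i (F n) p - wD L i f p)) @ \oo --> (0 : R)) &
        (forall s, (fun n => L2norm leb1 (side_dom L s)
           (fun t => F n (side_point L s t) - g s t)) @ \oo --> (0 : R))]].

Definition slip (k0 k1 : R) (s : side) : R :=
  match s with Bottom => k0 | Top => k1 | Left | Right => 0 end.

Definition dot (a b : 'I_2 -> R) : R := \sum_(i < 2) a i * b i.

Definition space_V L u : Prop :=
  [/\ forall i, H1 L (u i),
      {ae leb2, forall p, Omega L p -> \sum_(i < 2) wD L i (u i) p = 0} &
      exists2 g : 'I_2 -> side -> R -> R,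
        forall i, is_trace L (u i) (g i) &
        forall s, {ae leb1, forall t, side_dom L s t ->
          dot (fun i => g i s t) (normal s) = 0}].

(* Symmetric gradient of a vector field with gradient [G i j] = d_j u_i *)
Definition symgrad (G : 'I_2 -> 'I_2 -> R) (i j : 'I_2) : R :=
  2^-1 * (G i j + G j i).

Definition slip_condition (mu k0 k1 : R) L u : Prop :=
  exists (g : 'I_2 -> side -> R -> R) (G : 'I_2 -> 'I_2 -> side -> R -> R),
    [/\ forall i, is_trace L (u i) (g i),
        forall i j, is_trace L (wD L j (u i)) (G i j) &
        forall s, {ae leb1, forall t, side_dom L s t ->
          2 * mu * dot (fun i => dot (symgrad (fun a b => G a b s t) i) (normal s))
                       (tangent s)
          = slip k0 k1 s * dot (fun i => g i s t) (tangent s)}].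

Definition space_W (mu k0 k1 : R) L u : Prop :=
  [/\ space_V L u, forall i, H2 L (u i) & slip_condition mu k0 k1 L u].

Definition vec_L2norm L u : R :=
  Num.sqrt (\sum_(i < 2) L2norm leb2 (Omega L) (u i) ^+ 2).

Definition grad_L2norm L u : R :=
  Num.sqrt (\sum_(i < 2) \sum_(j < 2)
    L2norm leb2 (Omega L) (wD L j (u i)) ^+ 2).

Definition grad_H1norm L u : R :=
  Num.sqrt (\sum_(i < 2) \sum_(j < 2) H1norm L (wD L j (u i)) ^+ 2).

End Slip.

(* Main.v *)
Require Import Defs.
From HB Require Import structures.
From mathcomp Require Import all_boot all_order all_algebra.
From mathcomp Require Import all_classical all_reals all_analysis.
From mathcomp Require Import measurable_realfun ring lra.
Import Order.TTheory GRing.Theory Num.Theory.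
Import numFieldNormedType.Exports.

Set Implicit Arguments.
Unset Strict Implicit.
Unset Printing Implicit Defensive.

Local Open Scope classical_set_scope.
Local Open Scope ring_scope.

(* Integrating by parts on each side, |grad u|^2 is a boundary term minus the
   integral of u . lap u. The conditions u . n = 0 and slip turn the boundary
   term into (k0 / mu) times the integral of u_0^2 over the bottom side plus
   (k1 / mu) times the one over the top side; a further integration by parts
   in y, against a weight affine in y, bounds this by |u_0|^2 + |u_0| |d_y u_0|
   up to a constant. Finally |u_0| <= 2 |d_y u_0|, because u_0 is orthogonal to
   all functions of x alone (div u = 0 and u . n = 0), so that u_0 may be
   compared with F(x, y) - F(x, 0) for smooth F close to u_0.

   Weak derivatives only enter through the smooth approximations that define
   traces, so all integrations by parts are limits of the classical formula on
   the rectangle. That the tangential derivative of a vanishing trace vanishes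
   is used in the weak form [boundary_tangential], obtained from polynomial
   cutoffs and the symmetry of second derivatives of smooth functions. *)

(** * Square-integrable functions *)

Section SquareIntegrable.
Context {d : measure_display} {T : measurableType d} {R : realType}.
Variables (mu : {measure set T -> \bar R}) (D : set T).
Hypothesis mD : measurable D.
Implicit Types f g h : T -> R.

Let ip f g := \int[mu]_(x in D) (f x * g x).
Let norm2 f := L2norm mu D f.

Lemma integrable_EFinD f g : mu.-integrable D (EFin \o f) ->
  mu.-integrable D (EFin \o g) -> mu.-integrable D (EFin \o (fun x => f x + g x)).
Proof. by move=> If Ig; have := integrableD mD If Ig. Qed.

Lemma integrable_EFinZ (c : R) f : mu.-integrable D (EFin \o f) ->
  mu.-integrable D (EFin \o (fun x => c * f x)).
Proof. by move=> If; have := integrableZl mD c If. Qed.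

Lemma patch_sqr f : (fun x => ((f \_ D) x) ^+ 2) = (fun x => f x * f x) \_ D.
Proof.
apply/funext => x; rewrite !patchE; case: ifP => _ //=.
by rewrite expr0n.
Qed.

(** Trades membership of the restriction in [Lfun] for measurability on [D] and integrability of the
    square, the form in which all closure properties below are checked. *)
Lemma inL2P f : inL2 mu D f <->
  measurable_fun D f /\ mu.-integrable D (EFin \o (fun x => f x * f x)).
Proof.
split=> [f2|[mf If]].
- have mf : measurable_fun D f.
    move: (f2); rewrite /inL2 inE => /andP[]; rewrite inE/= => + _.
    by move/(measurable_restrictT _ mD).2.
  split => //; apply/(integrable_mkcond _ mD).2.
  have := Lfun2_integrable_sqr f2.
  rewrite patch_sqr; congr (is_true (integrable _ _ _)).
  by apply/funext => x; rewrite /= !patchE; case: ifP.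
- rewrite /inL2 inE; apply/andP; split; rewrite inE/=.
    exact/(measurable_restrictT _ mD).1.
  rewrite /finite_norm unlock /=; apply: poweR_lty.
  move/(integrable_mkcond _ mD).1: If => /integrableP[_].
  apply: le_lt_trans; rewrite le_eqVlt; apply/orP; left; apply/eqP.
  apply: eq_integral => x _ /=.
  rewrite !patchE; case: ifP => _ /=; last by rewrite normr0 powR0.
  by rewrite powR_mulrn// -normrX expr2 ger0_norm -expr2 ?sqr_ge0// ger0_norm ?sqr_ge0.
Qed.

Lemma inL2_measurable f : inL2 mu D f -> measurable_fun D f.
Proof. by move=> /inL2P[]. Qed.

(** The domination is |f g| <= f^2 + g^2. *)
Lemma inL2_mul_integrable f g : inL2 mu D f -> inL2 mu D g ->
  mu.-integrable D (EFin \o (fun x => f x * g x)).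
Proof.
move=> /inL2P[mf If] /inL2P[mg Ig].
apply: (@le_integrable _ _ _ _ _ mD _
  (EFin \o (fun x => f x * f x + g x * g x))).
- by apply/measurable_EFinP; exact: measurable_funM.
- move=> x Dx /=; rewrite lee_fin [leRHS]ger0_norm; last first.
    by rewrite addr_ge0// -expr2 sqr_ge0.
  rewrite normrM -[f x * f x]ger0_norm -1?expr2 ?sqr_ge0// -[g x * g x]ger0_norm -1?expr2
    ?sqr_ge0//.
  rewrite !normrX; have := sqr_ge0 (`|f x| - `|g x|).
  have : 0 <= `|f x| * `|g x| by rewrite mulr_ge0.
  nra.
- exact: integrable_EFinD.
Qed.

Lemma L2norm_sqr f : inL2 mu D f -> norm2 f ^+ 2 = ip f f.
Proof.
move=> f2; rewrite /norm2 /L2norm.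
have := poweR_Lnorm mu (EFin \o f \_ D) (_ : 2 != 0).
move=> /(_ (lt0r_neq0 (ltr0n _ 2))) H.
have N0 := Lnorm_ge0 mu 2%:E (EFin \o f \_ D).
have Nfin : ('N[mu]_2%:E[EFin \o f \_ D] < +oo)%E.
  by move: f2; rewrite /inL2 inE => /andP[_]; rewrite inE.
have : ('N[mu]_2%:E[EFin \o f \_ D])%E \is a fin_num by rewrite ge0_fin_numE.
move: H N0; case: ('N[mu]_2%:E[EFin \o f \_ D])%E => // r H; rewrite lee_fin => r0 _.
rewrite /= -[r ^+ 2]powR_mulrn// /ip Rintegral_mkcond /Rintegral.
transitivity (fine ((r%:E `^ 2)%E)) => //; rewrite H; congr fine.
apply: eq_integral => x _ /=; rewrite !patchE; case: ifP => _ /=;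
  last by rewrite normr0 powR0.
by rewrite powR_mulrn// -normrX expr2 ger0_norm// -expr2 sqr_ge0.
Qed.

Lemma L2norm_ge0 f : 0 <= norm2 f.
Proof. by apply: fine_ge0; exact: Lnorm_ge0. Qed.

Lemma inL2_mulb f g (M : R) : measurable_fun D g ->
  (forall x, D x -> `|g x| <= M) -> inL2 mu D f -> inL2 mu D (fun x => g x * f x).
Proof.
move=> mg gM /inL2P[mf If]; apply/inL2P; split; first exact: measurable_funM.
apply: (@le_integrable _ _ _ _ _ mD _ (EFin \o (fun x => M ^+ 2 * (f x * f x)))).
- by apply/measurable_EFinP; do 2![apply: measurable_funM => //].
- move=> x Dx /=; rewrite lee_fin mulrACA !normrM -!expr2 real_normK ?num_real//.
  rewrite ler_wpM2r ?sqr_ge0//.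
  have M0 : 0 <= M by apply: le_trans (gM _ Dx).
  by rewrite (ger0_norm M0) -(real_normK (num_real (g x))) lerXn2r ?nnegrE ?normr_ge0 ?gM.
- exact: integrable_EFinZ.
Qed.

Lemma inL2_bounded f (M : R) : (mu D < +oo)%E -> measurable_fun D f ->
  (forall x, D x -> `|f x| <= M) -> inL2 mu D f.
Proof.
move=> muD mf fM; apply/inL2P; split => //.
apply: measurable_bounded_integrable => //; first exact: measurable_funM.
exists (M ^+ 2); split; first exact: num_real.
move=> N MN x Dx /=; apply: le_trans (ltW MN).
by rewrite -expr2 normrX lerXn2r ?nnegrE ?(le_trans _ (fM _ Dx))// fM.
Qed.

Lemma inL2D f g : inL2 mu D f -> inL2 mu D g -> inL2 mu D (fun x => f x + g x).
Proof.
move=> f2 g2; have fg := inL2_mul_integrable f2 g2.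
move: f2 g2 => /inL2P[mf If] /inL2P[mg Ig]; apply/inL2P; split.
  exact: measurable_funD.
rewrite (_ : (fun x => _) = (fun x => f x * f x + (2 * (f x * g x) + g x * g x)));
  last first.
  by apply/funext => x; ring.
by do 2!apply: integrable_EFinD => //; exact: integrable_EFinZ.
Qed.

Lemma inL2Z f (c : R) : inL2 mu D f -> inL2 mu D (fun x => c * f x).
Proof. exact: inL2_mulb. Qed.

Lemma inL2B f g : inL2 mu D f -> inL2 mu D g -> inL2 mu D (fun x => f x - g x).
Proof.
move=> f2 /(inL2Z (-1)) g2; have := inL2D f2 g2.
by under eq_fun do rewrite mulN1r.
Qed.

(** The integral of (t f + g)^2 is a polynomial of degree at most 2 in t that is nowhere negative,
    so its discriminant is nonpositive. *)
Lemma L2_CauchySchwarz f g : inL2 mu D f -> inL2 mu D g ->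
  `|ip f g| <= norm2 f * norm2 g.
Proof.
move=> f2 g2.
rewrite -[leRHS]ger0_norm ?mulr_ge0 ?L2norm_ge0// -ler_sqr ?nnegrE//.
rewrite real_normK ?num_real// real_normK ?num_real// exprMn !L2norm_sqr//.
have ff := inL2_mul_integrable f2 f2; have gg := inL2_mul_integrable g2 g2.
have fg := inL2_mul_integrable f2 g2.
pose p := Poly [:: ip g g; 2 * ip f g; ip f f].
have : p`_1 ^+ 2 - 4 * p`_2 * p`_0 <= 0.
  rewrite deg_le2_poly_ge0 ?size_Poly// => t.
  rewrite horner_Poly/= mul0r add0r.
  have -> : (ip f f * t + 2 * ip f g) * t + ip g g =
     \int[mu]_(x in D) ((t * f x + g x) * (t * f x + g x)).
    rewrite -(_ : (fun x => (t ^+ 2 * (f x * f x) + (2 * t) * (f x * g x)) + g x * g x) =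
      (fun x => (t * f x + g x) * (t * f x + g x))); last first.
      by apply/funext => x; ring.
    have i1 : mu.-integrable D (EFin \o (fun x => t ^+ 2 * (f x * f x))).
      exact: integrable_EFinZ.
    have i2 : mu.-integrable D (EFin \o (fun x => 2 * t * (f x * g x))).
      exact: integrable_EFinZ.
    rewrite RintegralD//; last exact: integrable_EFinD.
    by rewrite RintegralD// !RintegralZl// /ip; ring.
  by apply: Rintegral_ge0 => x _; rewrite -expr2 sqr_ge0.
rewrite !coefE/=; lra.
Qed.

Lemma RintegralB_ip f g h : inL2 mu D f -> inL2 mu D g -> inL2 mu D h ->
  ip (fun x => f x - g x) h = ip f h - ip g h.
Proof.
move=> f2 g2 h2; rewrite /ip -RintegralB//; [|exact: inL2_mul_integrable..].
by apply: eq_Rintegral => x _; rewrite mulrBl.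
Qed.

Lemma ip_comm f g : ip f g = ip g f.
Proof. by apply: eq_Rintegral => x _; rewrite mulrC. Qed.

Lemma L2norm_mulb f g (M : R) : 0 <= M -> measurable_fun D g ->
  (forall x, D x -> `|g x| <= M) -> inL2 mu D f ->
  norm2 (fun x => g x * f x) <= M * norm2 f.
Proof.
move=> M0 mg gM f2.
have gf2 : inL2 mu D (fun x => g x * f x) by apply: inL2_mulb gM _.
rewrite -ler_sqr ?nnegrE ?mulr_ge0 ?L2norm_ge0// exprMn !L2norm_sqr//.
rewrite /ip -RintegralZl//; last exact: inL2_mul_integrable.
apply: le_Rintegral => //.
- exact: inL2_mul_integrable.
- by apply: integrable_EFinZ => //; exact: inL2_mul_integrable.
- move=> x Dx; rewrite mulrACA ler_wpM2r// -expr2 ?sqr_ge0//.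
  by rewrite -(real_normK (num_real (g x))) lerXn2r ?nnegrE// gM.
Qed.

Lemma cvg_L2norm_mulb (f_ : nat -> T -> R) f g (M : R) : measurable_fun D g ->
  (forall x, D x -> `|g x| <= M) ->
  (forall n, inL2 mu D (f_ n)) -> inL2 mu D f ->
  (fun n => norm2 (fun x => f_ n x - f x)) @ \oo --> (0 : R) ->
  (fun n => norm2 (fun x => g x * f_ n x - g x * f x)) @ \oo --> (0 : R).
Proof.
move=> mg gM f_2 f2 cf.
apply: (@squeeze_cvgr _ _ _ _ (cst 0) (fun n => `|M| * norm2 (fun x => f_ n x - f x))).
- apply: nearW => n; rewrite L2norm_ge0 /=.
  under eq_fun do rewrite -mulrBr.
  apply: L2norm_mulb => //; last exact: inL2B.
  by move=> x Dx; apply: le_trans (gM _ Dx) (ler_norm _).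
- exact: cvg_cst.
- by rewrite -[X in _ --> X](mulr0 `|M|); apply: cvgMl_tmp.
Qed.

(** Writes f_n g_n - f g as (f_n - f)(g_n - g) + f (g_n - g) + (f_n - f) g and applies
    Cauchy-Schwarz to each term; [err] is the resulting bound. *)
Lemma cvg_ip (f_ g_ : nat -> T -> R) f g :
  (forall n, inL2 mu D (f_ n)) -> inL2 mu D f ->
  (forall n, inL2 mu D (g_ n)) -> inL2 mu D g ->
  (fun n => norm2 (fun x => f_ n x - f x)) @ \oo --> (0 : R) ->
  (fun n => norm2 (fun x => g_ n x - g x)) @ \oo --> (0 : R) ->
  (fun n => ip (f_ n) (g_ n)) @ \oo --> ip f g.
Proof.
move=> f_2 f2 g_2 g2 cf cg.
apply/subr_cvg0.
pose nf n := norm2 (fun x => f_ n x - f x).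
pose ng n := norm2 (fun x => g_ n x - g x).
pose err n := nf n * ng n + norm2 f * ng n + nf n * norm2 g.
have err0 : err @ \oo --> (0 : R).
  rewrite -[X in _ --> X](_ : 0 * 0 + norm2 f * 0 + 0 * norm2 g = 0); last by ring.
  by apply: cvgD; [apply: cvgD; [exact: cvgM|exact: cvgMl_tmp]|exact: cvgMr_tmp].
apply: (@squeeze_cvgr _ _ _ _ (fun n => - err n) err) => //; last first.
  by rewrite -oppr0; apply: cvgN.
apply: nearW => n /=; rewrite -ler_norml.
have fb := inL2B (f_2 n) f2; have gb := inL2B (g_2 n) g2.
have -> : ip (f_ n) (g_ n) - ip f g =
    ip (fun x => f_ n x - f x) (fun x => g_ n x - g x) +
    ip f (fun x => g_ n x - g x) + ip (fun x => f_ n x - f x) g.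
  rewrite RintegralB_ip// [ip (f_ n) (fun _ => _ - _)]ip_comm.
  rewrite [ip f (fun _ => _ - _)]ip_comm.
  rewrite !RintegralB_ip// ![ip _ (f_ n)]ip_comm ![ip _ f]ip_comm.
  ring.
apply: le_trans (ler_normD _ _) _; apply: lerD; last exact: L2_CauchySchwarz.
apply: le_trans (ler_normD _ _) _; apply: lerD; exact: L2_CauchySchwarz.
Qed.

Lemma cvg_L2norm (f_ : nat -> T -> R) f :
  (forall n, inL2 mu D (f_ n)) -> inL2 mu D f ->
  (fun n => norm2 (fun x => f_ n x - f x)) @ \oo --> (0 : R) ->
  (fun n => norm2 (f_ n)) @ \oo --> norm2 f.
Proof.
move=> f_2 f2 cf.
have E h : inL2 mu D h -> norm2 h = Num.sqrt (ip h h).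
  by move=> h2; rewrite -L2norm_sqr// sqrtr_sqr ger0_norm// L2norm_ge0.
rewrite E//; under eq_fun do rewrite E//.
apply: continuous_cvg; first exact: sqrt_continuous.
exact: cvg_ip.
Qed.

(** Dominated convergence with |f| as the dominating function. It removes the cutoffs once the
    boundary terms they kill are gone. *)
Lemma cvg_Rintegral_cutoff f (c : nat -> T -> R) :
  mu.-integrable D (EFin \o f) ->
  (forall n, measurable_fun D (c n)) ->
  (forall n x, D x -> `|c n x| <= 1) ->
  (forall x, D x -> c ^~ x @ \oo --> (1 : R)) ->
  (fun n => \int[mu]_(x in D) (c n x * f x)) @ \oo --> \int[mu]_(x in D) f x.
Proof.
move=> If mc c1 cc.
have mf : measurable_fun D f by apply/measurable_EFinP; exact: measurable_int If.
apply: fine_cvg; rewrite fineK; last exact: integrable_fin_num.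
apply: (@dominated_cvg _ _ _ mu D mD (fun n x => (c n x * f x)%:E) (EFin \o f)
  (fun x => `|f x|%:E)) => //.
- by move=> n; apply/measurable_EFinP; exact: measurable_funM.
- move=> x Dx; apply: cvg_EFin; first exact: nearW.
  by rewrite -[X in _ --> X]mul1r; apply: cvgMr_tmp; exact: cc.
- exact: integrable_norm.
- by move=> n x Dx; rewrite /= lee_fin normrM ler_piMl// c1.
Qed.

End SquareIntegrable.

(** * Calculus in the plane *)

Lemma ord2_cases (j : 'I_2) : j = 0 \/ j = 1.
Proof. by case: j => [[|[|//]]] ?; [left|right]; exact/val_inj. Qed.

Section ContinuouslyDifferentiable.
Context {R : realType}.
Implicit Types f g : R * R -> R.

(** Green's formula needs only [C1] and the symmetry of second derivatives only [C2]. Both classes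
    are closed under products by the product rule alone, whereas [smooth] would call for an
    induction over all iterated partial derivatives. *)
Definition C1 f := (forall p, differentiable f p) /\
  forall i, continuous (pderiv i f).

Definition C2 f := C1 f /\ forall i, C1 (pderiv i f).

Lemma smooth_C2 f : smooth f -> C2 f.
Proof.
move=> sf; have s1 i : C1 (foldr pderiv f i).
  split=> [p|j p]; first exact: sf.
  by apply: differentiable_continuous; exact: (sf (j :: i)).
by split=> [|i]; [exact: (s1 [::])|exact: (s1 [:: i])].
Qed.

Lemma C1_continuous f : C1 f -> continuous f.
Proof. by move=> [df _] p; exact: differentiable_continuous. Qed.

Lemma pderiv_cst i (c : R) : pderiv i (fun=> c) = fun=> 0.
Proof. by apply/funext => p; rewrite /pderiv derive_cst. Qed.

Lemma pderivD i f g : C1 f -> C1 g ->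
  pderiv i (fun p => f p + g p) = fun p => pderiv i f p + pderiv i g p.
Proof.
move=> [df _] [dg _]; apply/funext => p; rewrite /pderiv.
by rewrite -deriveD//; exact: diff_derivable.
Qed.

Lemma pderivM i f g : C1 f -> C1 g -> pderiv i (fun p => f p * g p) =
  fun p => f p * pderiv i g p + pderiv i f p * g p.
Proof.
move=> [df _] [dg _]; apply/funext => p; rewrite /pderiv [_ * g p]mulrC.
by rewrite -deriveM//; exact: diff_derivable.
Qed.

Lemma continuous_addf f g : continuous f -> continuous g ->
  continuous (fun p => f p + g p).
Proof. by move=> cf cg p; exact: (cvgD (cf p) (cg p)). Qed.

Lemma continuous_mulf f g : continuous f -> continuous g ->
  continuous (fun p => f p * g p).
Proof. by move=> cf cg p; exact: (cvgM (cf p) (cg p)). Qed.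

Lemma C1_cst (c : R) : C1 (fun=> c).
Proof.
split=> [p|i]; first exact: differentiable_cst.
by rewrite pderiv_cst => p; exact: cvg_cst.
Qed.

Lemma C1D f g : C1 f -> C1 g -> C1 (fun p => f p + g p).
Proof.
move=> cf cg; split=> [p|i].
  by apply: differentiableD; [exact: cf.1|exact: cg.1].
by rewrite pderivD//; exact: continuous_addf (cf.2 i) (cg.2 i).
Qed.

Lemma C1M f g : C1 f -> C1 g -> C1 (fun p => f p * g p).
Proof.
move=> cf cg; split=> [p|i].
  by apply: differentiableM; [exact: cf.1|exact: cg.1].
rewrite pderivM//.
exact: continuous_addf (continuous_mulf (C1_continuous cf) (cg.2 i))
  (continuous_mulf (cf.2 i) (C1_continuous cg)).
Qed.

Lemma C2_cst (c : R) : C2 (fun=> c).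
Proof. by split=> [|i]; rewrite ?pderiv_cst; exact: C1_cst. Qed.

Lemma C2D f g : C2 f -> C2 g -> C2 (fun p => f p + g p).
Proof.
move=> cf cg; split=> [|i]; first exact: C1D cf.1 cg.1.
by rewrite (pderivD i cf.1 cg.1); apply: C1D; [exact: cf.2|exact: cg.2].
Qed.

Lemma C2M f g : C2 f -> C2 g -> C2 (fun p => f p * g p).
Proof.
move=> cf cg; split=> [|i]; first exact: C1M cf.1 cg.1.
rewrite (pderivM i cf.1 cg.1).
exact: C1D (C1M cf.1 (cg.2 i)) (C1M (cf.2 i) cg.1).
Qed.

Lemma C2X f n : C2 f -> C2 (fun p => f p ^+ n).
Proof.
move=> cf; elim: n => [|n IH]; first exact: C2_cst.
by under eq_fun do rewrite exprS; exact: C2M.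
Qed.

Lemma differentiable_lin f p : linear f -> continuous f -> differentiable f p.
Proof.
move=> lf cf.
pose F : {linear (R * R)%type -> R} :=
  HB.pack f (GRing.isLinear.Build R (R * R)%type R _ f lf).
exact: (@linear_differentiable R _ _ F p cf).
Qed.

Lemma pderiv_linear i f : linear f -> continuous f ->
  pderiv i f = fun=> f (evec i).
Proof.
move=> lf cf; apply/funext => p.
rewrite /pderiv deriveE; last exact: differentiable_lin.
pose F : {linear (R * R)%type -> R} :=
  HB.pack f (GRing.isLinear.Build R (R * R)%type R _ f lf).
by rewrite (diff_lin (f := F)).
Qed.

Lemma C2_linear f : linear f -> continuous f -> C2 f.
Proof.
move=> lf cf; split=> [|i]; last by rewrite pderiv_linear//; exact: C1_cst.
split=> [p|i]; first exact: differentiable_lin.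
by rewrite pderiv_linear// => p; exact: cvg_cst.
Qed.

Lemma C2_fst : C2 (fst : R * R -> R).
Proof. by apply: C2_linear => // p; exact: cvg_fst. Qed.

Lemma C2_snd : C2 (snd : R * R -> R).
Proof. by apply: C2_linear => // p; exact: cvg_snd. Qed.

Lemma is_derive_fst f (x y : R) : differentiable f (x, y) ->
  is_derive x 1 (fun t => f (t, y)) (pderiv 0 f (x, y)).
Proof.
move=> /(@diff_derivable _ _ _ _ _ (evec 0)) df.
have E : (fun h : R => h^-1 *: (f (h *: evec 0 + (x, y)) - f (x, y))) =
         (fun h : R => h^-1 *: ((fun t => f (t, y)) (h *: 1 + x) - f (x, y))).
  apply/funext => h; rewrite /evec/=; congr (_ *: (f _ - _)).
  by apply: injective_projections => //=; rewrite scaler0 add0r.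
apply: DeriveDef; first by rewrite /derivable -E.
by rewrite /pderiv /derive E.
Qed.

Lemma is_derive_snd f (x y : R) : differentiable f (x, y) ->
  is_derive y 1 (fun t => f (x, t)) (pderiv 1 f (x, y)).
Proof.
move=> /(@diff_derivable _ _ _ _ _ (evec 1)) df.
have E : (fun h : R => h^-1 *: (f (h *: evec 1 + (x, y)) - f (x, y))) =
         (fun h : R => h^-1 *: ((fun t => f (x, t)) (h *: 1 + y) - f (x, y))).
  apply/funext => h; rewrite /evec/=; congr (_ *: (f _ - _)).
  by apply: injective_projections => //=; rewrite scaler0 add0r.
apply: DeriveDef; first by rewrite /derivable -E.
by rewrite /pderiv /derive E.
Qed.

Lemma is_derive_continuous (h h' : R -> R) :
  (forall x : R, is_derive x (1 : R) h (h' x)) -> continuous h.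
Proof.
move=> dh x; apply/differentiable_continuous/derivable1_diffP.
exact: ex_derive.
Qed.

Lemma pderiv_fst_comp (h h' : R -> R) : (forall x : R, is_derive x (1 : R) h (h' x)) ->
  pderiv 0 (fun p : R * R => h p.1) = (fun p => h' p.1) /\
  pderiv 1 (fun p : R * R => h p.1) = (fun=> 0).
Proof.
move=> dh; split; apply/funext => -[x y]; rewrite /pderiv /derive /evec/=.
  rewrite -[RHS](@derive_val _ _ _ _ _ _ _ (dh x)); congr (lim (_ @ _)).
rewrite (_ : (fun t : R => _) = cst 0) ?lim_cst//.
by apply/funext => t /=; rewrite [(t *: 0)%R]scaler0 add0r subrr scaler0.
Qed.

Lemma C1_fst_comp (h h' : R -> R) : (forall x : R, is_derive x (1 : R) h (h' x)) ->
  continuous h' -> C1 (fun p => h p.1).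
Proof.
move=> dh ch; have [e0 e1] := pderiv_fst_comp dh; split=> [p|i].
  apply: differentiable_comp; first exact: C2_fst.1.1.
  by apply/derivable1_diffP; apply: ex_derive.
have [->|->] := ord2_cases i.
  by rewrite e0 => p; apply: continuous_comp; [exact: cvg_fst|exact: ch].
by rewrite e1 => p; exact: cvg_cst.
Qed.

End ContinuouslyDifferentiable.

(** * Measurability and boundedness of continuous functions; the fundamental theorem of calculus *)

Section PlaneMeasurability.
Context {R : realType}.
Local Notation plane := (measurableTypeR R * measurableTypeR R)%type.

(** Measurability refers to the product sigma-algebra, so an open set is exhibited as the countable
    union of the rational boxes it contains; [F] replaces the other boxes by the empty set. *)
Lemma open_measurable2 (O : set (R * R)) : open O -> measurable (O : set plane).
Proof.
move=> oO.
pose box (a b c d : rat) : set plane :=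
  `]ratr a, ratr b[%classic `*` `]ratr c, ratr d[%classic.
pose F a b c d := if `[< box a b c d `<=` O >] then box a b c d else set0.
have -> : O = \bigcup_a \bigcup_b \bigcup_c \bigcup_d F a b c d.
  apply/seteqP; split=> [[x y] Oxy|p [a _ [b _ [c _ [d _]]]]]; last first.
    by rewrite /F; case: asboolP => // + h; exact.
  have /nbhs_ballP[e /= e0 eO] := open_nbhs_nbhs (conj oO Oxy).
  have [a xa] : exists q : rat, ratr q \in `]x - e,
    x[ by apply: rat_in_itvoo; rewrite gtrBl.
  have [b xb] : exists q : rat, ratr q \in `]x,
    x + e[ by apply: rat_in_itvoo; rewrite ltrDl.
  have [c yc] : exists q : rat, ratr q \in `]y - e,
    y[ by apply: rat_in_itvoo; rewrite gtrBl.
  have [d yd] : exists q : rat, ratr q \in `]y,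
    y + e[ by apply: rat_in_itvoo; rewrite ltrDl.
  move: xa xb yc yd; rewrite !in_itv/= =>
    /andP[a1 a2] /andP[b1 b2] /andP[c1 c2] /andP[d1 d2].
  exists a => //; exists b => //; exists c => //; exists d => //.
  rewrite /F; case: asboolP => [_|]; first by split; rewrite /= in_itv/= ?a2 ?c2.
  case=> -[s t] [/=]; rewrite !in_itv/= => /andP[s1 s2] /andP[t1 t2].
  apply: eO; split; rewrite /= /ball/= ltr_distlC.
    by rewrite (lt_trans a1 s1) (lt_trans s2 b2).
  by rewrite (lt_trans c1 t1) (lt_trans t2 d2).
do 4!apply: bigcupT_measurable_rat => ?.
by rewrite /F; case: ifP => // _; apply: measurableX; exact: measurable_itv.
Qed.

Lemma continuous_measurable2 (f : R * R -> R) : continuous f ->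
  measurable_fun setT (f : plane -> R).
Proof.
move=> /continuousP cf; apply: (measurability _ (RGenOpens.measurableE R)).
move=> _ [_ [a [b ->] <-]]; rewrite setTI; apply: open_measurable2.
exact/cf/interval_open.
Qed.

Lemma continuous_bounded2 (f : R * R -> R) (a b c d : R) : continuous f ->
  exists M : R, forall p, (`[a, b] `*` `[c, d])%classic p -> `|f p| <= M.
Proof.
move=> cf.
have : compact (f @` (`[a, b] `*` `[c, d])%classic).
  apply: continuous_compact; first exact: continuous_subspaceT.
  by apply: compact_setX; exact: segment_compact.
move=> /compact_bounded[M [_ HM]]; exists (M + 1) => p Hp.
by apply: (HM (M + 1)); [rewrite ltrDl|exists p].
Qed.

Lemma continuous_bounded1 (f : R -> R) (a b : R) : continuous f ->
  exists M : R, forall p, `[a, b]%classic p -> `|f p| <= M.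
Proof.
move=> cf.
have : compact (f @` `[a, b]%classic).
  apply: continuous_compact; first exact: continuous_subspaceT.
  exact: segment_compact.
move=> /compact_bounded[M [_ HM]]; exists (M + 1) => p Hp.
by apply: (HM (M + 1)); [rewrite ltrDl|exists p].
Qed.

Lemma Rintegral_derivative (h h' : R -> R) (a b : R) : a < b ->
  (forall x : R, is_derive x (1 : R) h (h' x)) -> continuous h' ->
  (\int[leb1]_(t in `]a, b[) (h' t)%:E = (h b - h a)%:E)%E.
Proof.
move=> ab dh ch; rewrite EFinB.
rewrite -(@continuous_FTC2 _ h' h a b ab); last 3 first.
- exact: continuous_subspaceT.
- have ch' := is_derive_continuous dh.
  split=> [x _||]; first exact: ex_derive.
    by apply: cvg_at_right_filter; exact: ch'.
  by apply: cvg_at_left_filter; exact: ch'.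
- by move=> x _; rewrite derive1E derive_val.
by rewrite integral_itv_bndoo//; apply/measurable_EFinP/measurable_funTS;
  exact: continuous_measurable_fun.
Qed.

End PlaneMeasurability.

(** * Integration by parts on the rectangle *)

(* The two sides orthogonal to the [j]-th axis. *)
Definition upper_side (j : 'I_2) : side := if j == ord0 then Right else Top.
Definition lower_side (j : 'I_2) : side := if j == ord0 then Left else Bottom.

Section Green.
Context {R : realType}.
Variable L : R.
Hypothesis L_gt0 : 0 < L.
Local Notation plane := (measurableTypeR R * measurableTypeR R)%type.
Implicit Types f g : R * R -> R.

Definition side_values f : side -> R -> R := fun s t => f (side_point L s t).

(* The boundary integral of [a] against the [j]-th component of the normal. *)
Definition boundary (j : 'I_2) (a : side -> R -> R) : R :=
  \int[leb1]_(t in side_dom L (upper_side j)) a (upper_side j) t -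
  \int[leb1]_(t in side_dom L (lower_side j)) a (lower_side j) t.

Lemma OmegaE : Omega L = `]- L, L[%classic `*` `]0, 1[%classic.
Proof.
by apply/seteqP; split=> -[x y] /=; rewrite !in_itv/=.
Qed.

Lemma side_domE s : side_dom L s = match s with
  Bottom | Top => `]- L, L[%classic | Left | Right => `]0, 1[%classic end.
Proof. by case: s; apply/seteqP; split=> x /=; rewrite in_itv. Qed.

Lemma measurable_Omega : measurable (Omega L : set plane).
Proof. by rewrite OmegaE; apply: measurableX; exact: measurable_itv. Qed.

Lemma measurable_side_dom s : measurable (side_dom L s : set (measurableTypeR R)).
Proof. by rewrite side_domE; case: s; exact: measurable_itv. Qed.

Lemma leb2_Omega_fin : (leb2 (Omega L) < +oo)%E.
Proof.
rewrite OmegaE.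
have -> : leb2 (`]- L, L[ `*` `]0, 1[) =
  (@lebesgue_measure R `](- L)%R, L[%classic * @lebesgue_measure R `]0%R, 1%R[%classic)%E.
  by apply: product_measure1E; exact: measurable_itv.
by rewrite /= !lebesgue_measure_itv/=; do 2![case: ifP => _];
  rewrite -?EFinD -?EFinM ?mule0 ?mul0e ltry.
Qed.

Lemma leb1_side_fin s : (leb1 (side_dom L s) < +oo)%E.
Proof.
by rewrite side_domE /leb1; case: s; rewrite /= lebesgue_measure_itv/=; case: ifP => _;
  rewrite -?EFinD ltry.
Qed.

Lemma side_point_continuous s : continuous (side_point L s).
Proof.
by case: s => t; apply: (@cvg_pair _ _ _ _ (nbhs _) (nbhs _)) => /=;
  (exact: cvg_cst || exact: cvg_id).
Qed.

Lemma side_values_continuous f s : continuous f -> continuous (side_values f s).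
Proof. by move=> cf t; apply: continuous_comp;
  [exact: side_point_continuous|exact: cf]. Qed.

Lemma continuous_section_snd f (x : R) : continuous f -> continuous (fun y => f (x, y)).
Proof.
move=> cf y; apply: (@continuous_comp _ _ _ (fun y => (x, y)) f); last exact: cf.
by apply: (@cvg_pair _ _ _ _ (nbhs _) (nbhs _)); [exact: cvg_cst|exact: cvg_id].
Qed.

Lemma continuous_section_fst f (y : R) : continuous f -> continuous (fun x => f (x, y)).
Proof.
move=> cf x; apply: (@continuous_comp _ _ _ (fun x => (x, y)) f); last exact: cf.
by apply: (@cvg_pair _ _ _ _ (nbhs _) (nbhs _)); [exact: cvg_id|exact: cvg_cst].
Qed.

Lemma bounded_Omega f : continuous f ->
  exists M : R, forall p, Omega L p -> `|f p| <= M.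
Proof.
move=> /(@continuous_bounded2 _ _ (- L) L 0 1)[M HM]; exists M => p.
rewrite OmegaE => -[p1 p2]; apply: HM; split; exact: subset_itv_oo_cc.
Qed.

Lemma bounded_side (f : R -> R) s : continuous f ->
  exists M : R, forall t, side_dom L s t -> `|f t| <= M.
Proof.
move=> cf.
have [M HM] := @continuous_bounded1 _ _ (- L) L cf.
have [N HN] := @continuous_bounded1 _ _ 0 1 cf.
exists (Num.max M N) => t; rewrite side_domE le_max.
case: s => Ht; apply/orP;
  [left; apply: HM|left; apply: HM|right; apply: HN|right; apply: HN];
  exact: subset_itv_oo_cc Ht.
Qed.

Lemma inL2_continuous f : continuous f -> inL2 leb2 (Omega L) f.
Proof.
move=> cf; have [M HM] := bounded_Omega cf.
apply: (@inL2_bounded _ _ R leb2 (Omega L) measurable_Omega f M leb2_Omega_fin _ HM).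
by apply: measurable_funTS; exact: continuous_measurable2.
Qed.

Lemma inL2_continuous_side (f : R -> R) s : continuous f -> inL2 leb1 (side_dom L s) f.
Proof.
move=> cf; have [M HM] := bounded_side s cf.
apply: (@inL2_bounded _ _ R leb1 _ (measurable_side_dom s) f M (leb1_side_fin s) _ HM).
by apply: measurable_funTS; exact: continuous_measurable_fun.
Qed.

Lemma integrable_Omega f : continuous f -> leb2.-integrable (Omega L) (EFin \o f).
Proof.
move=> cf; have [M HM] := bounded_Omega cf.
apply: measurable_bounded_integrable; [exact: measurable_Omega|exact: leb2_Omega_fin| |].
  by apply: measurable_funTS; exact: continuous_measurable2.
exists M; split; first exact: num_real.
by move=> N MN x Dx /=; apply: le_trans (ltW MN); exact: HM.
Qed.

Lemma integrable_side (f : R -> R) s : continuous f ->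
  leb1.-integrable (side_dom L s) (EFin \o f).
Proof.
move=> cf; have [M HM] := bounded_side s cf.
apply: measurable_bounded_integrable;
  [exact: measurable_side_dom|exact: leb1_side_fin| |].
  by apply: measurable_funTS; exact: continuous_measurable_fun.
exists M; split; first exact: num_real.
by move=> N MN x Dx /=; apply: le_trans (ltW MN); exact: HM.
Qed.

(** Fubini with y as the inner variable, then the fundamental theorem of calculus on each vertical
    segment. *)
Lemma Green_snd f : C1 f ->
  \int[leb2]_(p in Omega L) pderiv 1 f p = boundary 1 (side_values f).
Proof.
move=> cf.
have Iint := integrable_Omega (cf.2 1).
move/(integrable_mkcond _ measurable_Omega).1: (Iint) => Iint0.
rewrite /Rintegral integral_mkcond /leb2.
rewrite -(integral12_prod_meas1 Iint0).
transitivity (fine (\int[leb1]_x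
  ((EFin \o (fun x : R => (f (x, 1%R) - f (x, 0%R))%R)) \_ (side_dom L Top)) x)%E).
  congr fine; apply: eq_integral => x _ /=.
  (* For fixed x the restriction to the rectangle is either a restriction to (0, 1) in y or
     identically 0. *)
  transitivity (\int[leb1]_(y in `]0%R,
    1%R[) if x \in side_dom L Top then (pderiv 1 f (x, y))%:E else 0)%E.
    rewrite [RHS]integral_mkcond; apply: eq_integral => y _.
    rewrite !patchE OmegaE side_domE.
    rewrite /= in_setX; case: (x \in _) => /=; first by [].
    by rewrite if_same.
  rewrite patchE; case: ifP => xL; last by rewrite integral0.
  rewrite (Rintegral_derivative ltr01 (fun y => is_derive_snd (cf.1 (x, y))))//.
  by apply: continuous_section_snd; exact: cf.2.
rewrite -integral_mkcond /boundary -RintegralB//.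
- exact: measurable_side_dom.
- by apply: integrable_side; exact: side_values_continuous (C1_continuous cf).
- by apply: (@integrable_side _ Bottom); exact: side_values_continuous (C1_continuous cf).
Qed.

(** As for [Green_snd], with Fubini in the other order. *)
Lemma Green_fst f : C1 f ->
  \int[leb2]_(p in Omega L) pderiv 0 f p = boundary 0 (side_values f).
Proof.
move=> cf; have LL : - L < L by rewrite gtrN.
have Iint := integrable_Omega (cf.2 0).
move/(integrable_mkcond _ measurable_Omega).1: (Iint) => Iint0.
rewrite /Rintegral integral_mkcond /leb2.
rewrite -(integral21_prod_meas1 Iint0).
transitivity (fine (\int[leb1]_x
  ((EFin \o (fun y : R => (f (L, y) - f ((- L)%R, y))%R)) \_ (side_dom L Right)) x)%E).
  congr fine; apply: eq_integral => y _ /=.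
  transitivity (\int[leb1]_(x in `](- L)%R,
    L[) if y \in side_dom L Right then (pderiv 0 f (x, y))%:E else 0)%E.
    rewrite [RHS]integral_mkcond; apply: eq_integral => x _.
    rewrite !patchE OmegaE side_domE.
    rewrite /= in_setX; case: (y \in _) => /=; first by rewrite andbT.
    by rewrite andbF if_same.
  rewrite patchE; case: ifP => xL; last by rewrite integral0.
  rewrite (Rintegral_derivative LL (fun x => is_derive_fst (cf.1 (x, y))))//.
  by apply: continuous_section_fst; exact: cf.2.
rewrite -integral_mkcond /boundary -RintegralB//.
- exact: measurable_side_dom.
- by apply: integrable_side; exact: side_values_continuous (C1_continuous cf).
- by apply: (@integrable_side _ Left); exact: side_values_continuous (C1_continuous cf).
Qed.

Lemma Green j f : C1 f ->
  \int[leb2]_(p in Omega L) pderiv j f p = boundary j (side_values f).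
Proof.
have [->|->] := ord2_cases j.
  exact: Green_fst.
exact: Green_snd.
Qed.

End Green.

(** * Symmetry of second derivatives *)

Section Schwarz.
Context {R : realType}.

(** The mean value theorem in x for t |-> f(t, y + h) - f(t, y), then in y for the x-derivative of f
    at the point found. *)
Lemma second_difference_fst (f : R * R -> R) (x y h : R) : 0 < h -> C2 f ->
  exists2 q, [/\ x <= q.1 <= x + h & y <= q.2 <= y + h] &
  f (x + h, y + h) - f (x + h, y) - (f (x, y + h) - f (x, y)) =
  pderiv 1 (pderiv 0 f) q * h * h.
Proof.
move=> h0 cf.
have dx t z : is_derive t (1 : R) (fun t => f (t, z)) (pderiv 0 f (t, z)).
  exact: is_derive_fst (cf.1.1 _).
have dy t z : is_derive z (1 : R) (fun z => pderiv 0 f (t, z))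
  (pderiv 1 (pderiv 0 f) (t, z)).
  exact: is_derive_snd ((cf.2 0).1 _).
have dd t : is_derive t (1 : R) (fun t => f (t, y + h) - f (t, y))
    (pderiv 0 f (t, y + h) - pderiv 0 f (t, y)).
  exact: is_deriveB.
have [c cx Ec] := @MVT_segment R _ _ x (x + h) (ler_wpDr (ltW h0) (lexx _))
  (fun t _ => dd t) (continuous_subspaceT (is_derive_continuous dd)).
have [e ey Ee] := @MVT_segment R _ _ y (y + h) (ler_wpDr (ltW h0) (lexx _))
  (fun t _ => dy c t) (continuous_subspaceT (is_derive_continuous (dy c))).
exists (c, e); first by move: cx ey; rewrite !in_itv.
by rewrite Ec Ee /=; congr (_ * _ * _); rewrite addrAC subrr add0r.
Qed.

(** The same second difference, regrouped so that the mean value theorem is used first in y and then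
    in x; the mixed derivative appears in the other order. *)
Lemma second_difference_snd (f : R * R -> R) (x y h : R) : 0 < h -> C2 f ->
  exists2 q, [/\ x <= q.1 <= x + h & y <= q.2 <= y + h] &
  f (x + h, y + h) - f (x + h, y) - (f (x, y + h) - f (x, y)) =
  pderiv 0 (pderiv 1 f) q * h * h.
Proof.
move=> h0 cf.
have dy t z : is_derive z (1 : R) (fun z => f (t, z)) (pderiv 1 f (t, z)).
  exact: is_derive_snd (cf.1.1 _).
have dx t z : is_derive t (1 : R) (fun t => pderiv 1 f (t, z))
  (pderiv 0 (pderiv 1 f) (t, z)).
  exact: is_derive_fst ((cf.2 1).1 _).
have dd t : is_derive t (1 : R) (fun t => f (x + h, t) - f (x, t))
    (pderiv 1 f (x + h, t) - pderiv 1 f (x, t)).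
  exact: is_deriveB.
have [e ey Ee] := @MVT_segment R _ _ y (y + h) (ler_wpDr (ltW h0) (lexx _))
  (fun t _ => dd t) (continuous_subspaceT (is_derive_continuous dd)).
have [c cx Ec] := @MVT_segment R _ _ x (x + h) (ler_wpDr (ltW h0) (lexx _))
  (fun t _ => dx t e) (continuous_subspaceT (is_derive_continuous (dx ^~ e))).
exists (c, e); first by move: cx ey; rewrite !in_itv.
rewrite (_ : _ - _ = f (x + h, y + h) - f (x, y + h) - (f (x + h, y) - f (x, y)));
  last by ring.
by rewrite Ee Ec /=; congr (_ * _ * _); rewrite addrAC subrr add0r.
Qed.

(** The points [q] and [q'] may differ, since the two mean value arguments give unrelated points. If
    A and B differed at (x, y), then near it each would vary by less than half the gap [e], and the
    gap would be smaller than itself. *)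
Lemma eq_continuous_nearby (A B : R * R -> R) (x y : R) :
  continuous A -> continuous B ->
  (forall h, 0 < h -> exists q q' : R * R,
    [/\ x <= q.1 <= x + h, y <= q.2 <= y + h, x <= q'.1 <= x + h,
        y <= q'.2 <= y + h & A q = B q']) ->
  A (x, y) = B (x, y).
Proof.
move=> cA cB AB; apply/eqP; rewrite -subr_eq0; apply/negPn/negP => d0.
set e := `|A (x, y) - B (x, y)| / 2.
have e0 : 0 < e by rewrite divr_gt0// normr_gt0.
move/cvgrPdist_lt: (cA (x, y)) => /(_ e e0) {}cA.
move/cvgrPdist_lt: (cB (x, y)) => /(_ e e0) {}cB.
have [r /= r0 Hr] := (nbhs_ballP _ _).1 (@filterI _ (nbhs ((x, y) : R * R)) _ _ _ cA cB).
have h0 : 0 < r / 2 by rewrite divr_gt0.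
have inb q : x <= q.1 <= x + r / 2 -> y <= q.2 <= y + r / 2 -> ball (x, y) r q.
  have rr : r / 2 < r by rewrite gtr_pMr// invf_lt1// ltr1n.
  case: q => a b /= /andP[a1 a2] /andP[b1 b2]; split; rewrite /= /ball/= distrC.
    by rewrite ger0_norm ?subr_ge0// ltrBlDl; apply: le_lt_trans a2 _; rewrite ltrD2l.
  by rewrite ger0_norm ?subr_ge0// ltrBlDl; apply: le_lt_trans b2 _; rewrite ltrD2l.
have [q [q' [q1 q2 q1' q2' EAB]]] := AB _ h0.
have [Aq _] := Hr _ (inb _ q1 q2); have [_ Bq] := Hr _ (inb _ q1' q2').
suff : `|A (x, y) - B (x, y)| < `|A (x, y) - B (x, y)| by rewrite ltxx.
rewrite {1}(_ : A (x, y) - B (x, y) = (A (x, y) - A q) - (B (x, y) - B q')); last first.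
  by rewrite EAB; ring.
apply: le_lt_trans (ler_normB _ _) _; rewrite [ltRHS](splitr) -/e.
exact: ltrD.
Qed.

Lemma pderivC (f : R * R -> R) i j : C2 f ->
  pderiv i (pderiv j f) = pderiv j (pderiv i f).
Proof.
move=> cf; have H : pderiv 1 (pderiv 0 f) = pderiv 0 (pderiv 1 f).
  apply/funext => -[x y].
  apply: (eq_continuous_nearby ((cf.2 0).2 1) ((cf.2 1).2 0)) => h h0.
  have [q [q1 q2] Eq] := second_difference_fst x y h0 cf.
  have [q' [q1' q2'] Eq'] := second_difference_snd x y h0 cf.
  exists q, q'; split; [exact: q1|exact: q2|exact: q1'|exact: q2'|].
  have /(mulIf (lt0r_neq0 h0)) E := etrans (esym Eq) Eq'.
  exact: mulIf (lt0r_neq0 h0) _ _ E.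
have [->|->] := ord2_cases i; have [->|->] := ord2_cases j.
- exact: erefl.
- exact: esym H.
- exact: H.
- exact: erefl.
Qed.

End Schwarz.

(** * Integration by parts with traces *)

Section Traces.
Context {R : realType}.
Variable L : R.
Hypothesis L_gt0 : 0 < L.
Implicit Types (f h : R * R -> R) (df dh : 'I_2 -> R * R -> R) (g e : side -> R -> R).

Local Notation "'<<' f , h '>>'" := (\int[leb2]_(p in Omega L) (f p * h p)).

(* [df] plays the role of the weak gradient of [f] and [g] that of its trace. *)
Definition approximable f df g :=
  [/\ inL2 leb2 (Omega L) f, (forall i, inL2 leb2 (Omega L) (df i)),
   (forall s, inL2 leb1 (side_dom L s) (g s)) &
   exists2 F : nat -> R * R -> R, (forall n, C2 (F n)) &
    [/\ (fun n => L2norm leb2 (Omega L) (fun p => F n p - f p)) @ \oo --> (0 : R),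
        (forall i, (fun n => L2norm leb2 (Omega L)
           (fun p => pderiv i (F n) p - df i p)) @ \oo --> (0 : R)) &
        (forall s, (fun n => L2norm leb1 (side_dom L s)
           (fun t => side_values L (F n) s t - g s t)) @ \oo --> (0 : R))]].

(** [H1] makes the set of square-integrable weak derivatives inhabited, so [xget] picks a member of
    it. *)
Lemma wD_inL2 i f : H1 L f -> inL2 leb2 (Omega L) (wD L i f).
Proof. by move=> [_ /(_ i)[g Hg]]; have [] := xgetPex (cst 0) (ex_intro _ _ Hg). Qed.

Lemma trace_approximable f g : is_trace L f g -> approximable f (fun i => wD L i f) g.
Proof.
move=> [Hf Hg [F sF [F0 F1 F2]]]; split=> //; first exact: Hf.1.
  by move=> i; exact: wD_inL2.
by exists F => // n; exact: smooth_C2.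
Qed.

Lemma L2norm_subrr d (T : measurableType d) (mu : {measure set T -> \bar R})
    (D : set T) (f : T -> R) : L2norm mu D (fun x => f x - f x) = 0.
Proof.
rewrite /L2norm (_ : EFin \o _ = cst 0%E) ?Lnorm0//.
by apply/funext => x; rewrite /= patchE subrr; case: ifP.
Qed.

Lemma C2_approximable f : C2 f -> approximable f (pderiv^~ f) (side_values L f).
Proof.
move=> cf; split.
- by apply: inL2_continuous; exact: C1_continuous cf.1.
- by move=> i; apply: inL2_continuous; exact: cf.1.2.
- by move=> s; apply: inL2_continuous_side; apply: side_values_continuous;
    exact: C1_continuous cf.1.
exists (fun=> f) => //; split=> [|i|s];
  by under eq_fun do rewrite L2norm_subrr; exact: cvg_cst.
Qed.

Lemma cvg_boundary j (a a' : side -> R -> R) (b b' : nat -> side -> R -> R) :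
  (forall s, inL2 leb1 (side_dom L s) (a s)) ->
  (forall s, inL2 leb1 (side_dom L s) (a' s)) ->
  (forall n s, inL2 leb1 (side_dom L s) (b n s)) ->
  (forall n s, inL2 leb1 (side_dom L s) (b' n s)) ->
  (forall s, (fun n => L2norm leb1 (side_dom L s) (fun t => b n s t - a s t)) @ \oo -->
    (0 : R)) ->
  (forall s, (fun n => L2norm leb1 (side_dom L s) (fun t => b' n s t - a' s t)) @ \oo -->
    (0 : R)) ->
  (fun n => boundary L j (fun s t => b n s t * b' n s t)) @ \oo -->
    boundary L j (fun s t => a s t * a' s t).
Proof.
move=> a2 a'2 b2 b'2 ba ba'.
apply: cvgB.
  exact: (@cvg_ip _ _ _ leb1 _ (measurable_side_dom L (upper_side j))).
exact: (@cvg_ip _ _ _ leb1 _ (measurable_side_dom L (lower_side j))).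
Qed.

(** Green's formula for the product psi f h, expanded by the Leibniz rule. *)
Lemma Green_weighted j psi f h : C1 psi -> C1 f -> C1 h ->
  << (fun p => pderiv j psi p * f p), h >> + << (fun p => psi p * pderiv j f p), h >>
   + << (fun p => psi p * f p), pderiv j h >> =
  boundary L j (fun s t =>
    (side_values L psi s t * side_values L f s t) * side_values L h s t).
Proof.
move=> cp cf ch; rewrite -(Green L_gt0 j (C1M (C1M cp cf) ch)).
rewrite (pderivM _ (C1M cp cf) ch) (pderivM _ cp cf).
have [kp kf kh] := And3 (C1_continuous cp) (C1_continuous cf) (C1_continuous ch).
have i1 := integrable_Omega L (continuous_mulf (continuous_mulf (cp.2 j) kf) kh).
have i2 := integrable_Omega L (continuous_mulf (continuous_mulf kp (cf.2 j)) kh).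
have i3 := integrable_Omega L (continuous_mulf (continuous_mulf kp kf) (ch.2 j)).
have i12 := integrable_Omega L
  (continuous_addf (continuous_mulf (continuous_mulf (cp.2 j) kf) kh)
  (continuous_mulf (continuous_mulf kp (cf.2 j)) kh)).
have mO := measurable_Omega L.
rewrite -(RintegralD mO i1 i2) -(RintegralD mO i12 i3).
by apply: eq_Rintegral => p _; ring.
Qed.

(** The limit of [Green_weighted] along the approximating sequences of f and h: each term is a
    pairing of L^2-convergent sequences, and multiplication by psi or its derivative, bounded on the
    rectangle, preserves L^2 convergence. *)
Lemma parts_weighted j psi f df g h dh e : C1 psi ->
  approximable f df g -> approximable h dh e ->
  << (fun p => pderiv j psi p * f p), h >> + << (fun p => psi p * df j p), h >>
   + << (fun p => psi p * f p), dh j >> =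
  boundary L j (fun s t => (side_values L psi s t * g s t) * e s t).
Proof.
move=> cp [f2 df2 g2 [F cF [F0 F1 F2]]] [h2 dh2 e2 [H cH [H0 H1 H2]]].
have [M HM] := bounded_Omega L (C1_continuous cp).
have [N HN] := bounded_Omega L (cp.2 j).
have mp : measurable_fun (Omega L) psi.
  by apply: measurable_funTS; apply: continuous_measurable2; exact: C1_continuous.
have mdp : measurable_fun (Omega L) (pderiv j psi).
  by apply: measurable_funTS; apply: continuous_measurable2; exact: cp.2.
have kF n := C1_continuous (cF n).1; have kH n := C1_continuous (cH n).1.
have F2' n := inL2_continuous L (kF n).
have H2' n := inL2_continuous L (kH n).
have dF2 n := inL2_continuous L ((cF n).1.2 j).
have dH2 n := inL2_continuous L ((cH n).1.2 j).
have mO := measurable_Omega L.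
have c1 : (fun n => << (fun p => pderiv j psi p * F n p), H n >>) @ \oo -->
   << (fun p => pderiv j psi p * f p), h >>.
  apply: (cvg_ip mO) => //.
  - by move=> n; exact: (inL2_mulb mO mdp HN).
  - exact: (inL2_mulb mO mdp HN).
  - exact: (cvg_L2norm_mulb mO mdp HN).
have c2 : (fun n => << (fun p => psi p * pderiv j (F n) p), H n >>) @ \oo -->
   << (fun p => psi p * df j p), h >>.
  apply: (cvg_ip mO) => //.
  - by move=> n; exact: (inL2_mulb mO mp HM).
  - exact: (inL2_mulb mO mp HM).
  - exact: (cvg_L2norm_mulb mO mp HM).
have c3 : (fun n => << (fun p => psi p * F n p), pderiv j (H n) >>) @ \oo -->
   << (fun p => psi p * f p), dh j >>.
  apply: (cvg_ip mO) => //.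
  - by move=> n; exact: (inL2_mulb mO mp HM).
  - exact: (inL2_mulb mO mp HM).
  - exact: (cvg_L2norm_mulb mO mp HM).
have kp s : continuous (side_values L psi s) by apply: side_values_continuous;
  exact: C1_continuous.
have mps s : measurable_fun (side_dom L s) (side_values L psi s).
  by apply: measurable_funTS; exact: continuous_measurable_fun.
have F2s n s : inL2 leb1 (side_dom L s) (side_values L (F n) s).
  exact: inL2_continuous_side (side_values_continuous (kF n)).
have H2s n s : inL2 leb1 (side_dom L s) (side_values L (H n) s).
  exact: inL2_continuous_side (side_values_continuous (kH n)).
have c4 : (fun n => boundary L j
  (fun s t => (side_values L psi s t * side_values L (F n) s t) * side_values L (H n) s
  t)) @ \oo -->
   boundary L j (fun s t => (side_values L psi s t * g s t) * e s t).
  apply: cvg_boundary => //.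
  - move=> s; have [K HK] := bounded_side L s (kp s).
    exact: (inL2_mulb (measurable_side_dom L s) (mps s) HK).
  - move=> n s; have [K HK] := bounded_side L s (kp s).
    exact: (inL2_mulb (measurable_side_dom L s) (mps s) HK).
  - move=> s; have [K HK] := bounded_side L s (kp s).
    exact: (cvg_L2norm_mulb (measurable_side_dom L s) (mps s) HK).
apply: cvg_unique c4 => //.
apply: cvg_trans (cvgD (cvgD c1 c2) c3).
apply: near_eq_cvg; apply: nearW => n /=.
by rewrite -(Green_weighted j cp (cF n).1 (cH n).1).
Qed.

Lemma parts j f df g h dh e : approximable f df g -> approximable h dh e ->
  << df j, h >> + << f, dh j >> = boundary L j (fun s t => g s t * e s t).
Proof.
move=> af ah; have := parts_weighted j (C1_cst 1) af ah.
rewrite pderiv_cst.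
under eq_Rintegral do rewrite !mul0r.
under [X in _ + X + _]eq_Rintegral do rewrite mul1r.
under [X in _ + _ + X]eq_Rintegral do rewrite mul1r.
rewrite (_ : \int[_]_(_ in _) 0 = 0) ?add0r; last by rewrite /Rintegral integral0.
move=> ->; rewrite /boundary; congr (_ - _); apply: eq_Rintegral => t _;
  by rewrite /side_values mul1r.
Qed.

Lemma parts_test j psi f df g : C1 psi -> approximable f df g ->
  << pderiv j psi, f >> + << psi, df j >> =
    boundary L j (fun s t => side_values L psi s t * g s t).
Proof.
move=> cp af; have := parts_weighted j cp af (C2_approximable (C2_cst 1)).
under eq_Rintegral do rewrite mulr1.
under [X in _ + X + _]eq_Rintegral do rewrite mulr1.
under [X in _ + _ + X]eq_Rintegral do rewrite pderiv_cst mulr0.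
rewrite (_ : \int[_]_(_ in _) 0 = 0) ?addr0; last by rewrite /Rintegral integral0.
move=> ->; rewrite /boundary; congr (_ - _); apply: eq_Rintegral => t _;
  by rewrite /side_values mulr1.
Qed.

End Traces.

(** * Tangential derivatives of vanishing traces *)

Section Tangential.
Context {R : realType}.
Variable L : R.
Hypothesis L_gt0 : 0 < L.
Implicit Types (f h : R * R -> R) (df dh : 'I_2 -> R * R -> R) (g e : side -> R -> R).

Local Notation "'<<' f , h '>>'" := (\int[leb2]_(p in Omega L) (f p * h p)).

(* Maps [Omega L] to (-1, 1) and the sides orthogonal to the [i]-th axis to
   1 and -1. *)
Definition rescaled (i : 'I_2) (p : R * R) : R :=
  if i == ord0 then L^-1 * p.1 else 2 * p.2 - 1.

(** The polynomial 1 - r^(2n), with r the rescaled coordinate: it is 0 where r = 1 or r = -1, and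
    tends to 1 as n grows wherever |r| < 1. Being a polynomial, it is [C2] by the closure rules
    above. *)
Definition cutoff i n (p : R * R) : R := 1 + (-1) * rescaled i p ^+ (2 * n).

Lemma C2_cutoff i n : C2 (cutoff i n).
Proof.
have cr : C2 (rescaled i).
  rewrite /rescaled; case: (i == ord0); first exact: C2M (C2_cst _) C2_fst.
  exact: C2D (C2M (C2_cst _) C2_snd) (C2_cst _).
exact: C2D (C2_cst 1) (C2M (C2_cst (-1)) (C2X (2 * n) cr)).
Qed.

Lemma rescaled_lt1 i p : Omega L p -> `|rescaled i p| < 1.
Proof.
move=> [/andP[p1 p2] /andP[q1 q2]]; rewrite /rescaled; case: ifP => _.
  by rewrite normrM gtr0_norm ?invr_gt0// mulrC ltr_pdivrMr// mul1r ltr_norml p1.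
by rewrite ltr_norml; apply/andP; split; lra.
Qed.

(** On these sides the [i]-th coordinate is the parameter, and the inequality is strict because the
    corners are left out. *)
Lemma rescaled_side i j s t : i != j -> s = upper_side j \/ s = lower_side j ->
  side_dom L s t -> `|rescaled i (side_point L s t)| < 1.
Proof.
rewrite /upper_side /lower_side /rescaled => ij.
have -> : (i == ord0) = ~~ (j == ord0).
  by case: i j ij => [[|[|//]]] ? [[|[|//]]] ?.
case: (j == ord0) => -[]->/= /andP[p1 p2].
- by rewrite ltr_norml; apply/andP; split; lra.
- by rewrite ltr_norml; apply/andP; split; lra.
- by rewrite normrM gtr0_norm ?invr_gt0// mulrC ltr_pdivrMr// mul1r ltr_norml p1.
- by rewrite normrM gtr0_norm ?invr_gt0// mulrC ltr_pdivrMr// mul1r ltr_norml p1.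
Qed.

Lemma cutoff_le1 i n p : `|rescaled i p| < 1 -> `|cutoff i n p| <= 1.
Proof.
move=> r1; rewrite /cutoff mulN1r.
have : rescaled i p ^+ (2 * n) = `|rescaled i p| ^+ (2 * n).
  by rewrite !exprM real_normK ?num_real.
move=> ->; have : 0 <= `|rescaled i p| ^+ (2 * n) <= 1.
  by rewrite exprn_ge0// exprn_ile1// ltW.
by move=> /andP[a b]; rewrite ler_norml; apply/andP; split; lra.
Qed.

Lemma cutoff_cvg i p : `|rescaled i p| < 1 -> (cutoff i)^~ p @ \oo --> (1 : R).
Proof.
move=> r1; rewrite -[X in _ --> X](_ : 1 + (-1) * 0 = 1); last by rewrite mulr0 addr0.
apply: cvgD; first exact: cvg_cst.
apply: cvgMl_tmp; rewrite /cutoff.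
under eq_fun do rewrite exprM.
by apply: cvg_expr; rewrite normrX expr_lt1.
Qed.

Lemma cutoff_side i n s t : s = upper_side i \/ s = lower_side i ->
  side_values L (cutoff i n) s t = 0.
Proof.
rewrite /side_values /cutoff /upper_side /lower_side /rescaled exprM mulN1r.
case: (i == ord0) => -[]->/=.
- by rewrite mulVf ?gt_eqF// expr1n expr1n subrr.
- by rewrite mulrN mulVf ?gt_eqF// sqrrN expr1n expr1n subrr.
- by rewrite mulr1 (_ : 2 - 1 = 1 :> R) ?expr1n ?subrr//; lra.
- by rewrite mulr0 sub0r sqrrN !expr1n subrr.
Qed.

(** As [i != j], the [j]-th direction is tangential to these sides, and psi is constantly 0 along
    them. *)
Lemma pderiv_side psi i j s : C1 psi -> i != j -> s = upper_side i \/ s = lower_side i ->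
  (forall t, side_values L psi s t = 0) -> forall t, side_values L (pderiv j psi) s t = 0.
Proof.
move=> cpsi; rewrite /upper_side /lower_side => ij sE p0 t.
have [[i0 j0]|[i0 j0]] : (i == ord0 /\ j = 1) \/ ((i == ord0) = false /\ j = 0).
    by case: i j ij {sE} => [[|[|//]]] ? [[|[|//]]] ? // _; [left|right];
      split=> //; exact/val_inj.
- rewrite i0 in sE; rewrite j0;
    have [x E] : exists x, forall t, side_point L s t = (x, t).
    by case: sE => ->; [exists L|exists (- L)].
  have D := is_derive_snd (cpsi.1 (x, t)).
  rewrite /side_values E -(@derive_val _ _ _ _ _ _ _ D).
  rewrite (_ : (fun u => psi (x, u)) = cst 0) ?derive_cst//.
  by apply/funext => u; rewrite -E; exact: p0.
- rewrite i0 in sE; rewrite j0;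
    have [y E] : exists y, forall t, side_point L s t = (t, y).
    by case: sE => ->; [exists 1|exists 0].
  have D := is_derive_fst (cpsi.1 (t, y)).
  rewrite /side_values E -(@derive_val _ _ _ _ _ _ _ D).
  rewrite (_ : (fun u => psi (u, y)) = cst 0) ?derive_cst//.
  by apply/funext => u; rewrite -E; exact: p0.
Qed.

Lemma boundary_ae_eq j (a b : side -> R -> R) :
  (forall s, measurable_fun (side_dom L s) (a s)) ->
  (forall s, measurable_fun (side_dom L s) (b s)) ->
  (forall s, s = upper_side j \/ s = lower_side j ->
    {ae leb1, forall t, side_dom L s t -> a s t = b s t}) ->
  boundary L j a = boundary L j b.
Proof.
move=> ma mb ab; rewrite /boundary.
have E s : s = upper_side j \/ s = lower_side j ->
    \int[leb1]_(t in side_dom L s) a s t = \int[leb1]_(t in side_dom L s) b s t.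
  move=> /ab abs; congr fine; apply: ae_eq_integral.
  - exact: measurable_side_dom.
  - by apply/measurable_EFinP; exact: ma.
  - by apply/measurable_EFinP; exact: mb.
  - apply: filterS abs; first exact: (ae_filter_ringOfSetsType leb1).
    by move=> t /[apply] /= ->.
by rewrite !E; [|right|left].
Qed.

Lemma boundary0 j : boundary L j (fun _ _ => 0) = 0.
Proof. by rewrite /boundary /Rintegral !integral0 subrr. Qed.

Lemma boundaryB j (a b : side -> R -> R) :
  (forall s, leb1.-integrable (side_dom L s) (EFin \o a s)) ->
  (forall s, leb1.-integrable (side_dom L s) (EFin \o b s)) ->
  boundary L j (fun s t => a s t - b s t) = boundary L j a - boundary L j b.
Proof.
move=> Ia Ib; rewrite /boundary !RintegralB//; [|exact: measurable_side_dom..].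
by rewrite !opprB addrACA [RHS]addrACA [- _ + _]addrC.
Qed.

Lemma boundary_eq0 j (a : side -> R -> R) :
  (forall s, measurable_fun (side_dom L s) (a s)) ->
  (forall s, s = upper_side j \/ s = lower_side j ->
    {ae leb1, forall t, side_dom L s t -> a s t = 0}) ->
  boundary L j a = 0.
Proof. by move=> ma a0; rewrite (boundary_ae_eq ma _ a0) ?boundary0. Qed.

(** * A function whose trace vanishes on the sides orthogonal to the [j]-th axis *)

Section VanishingTrace.
Variables (i j : 'I_2) (f : R * R -> R) (df : 'I_2 -> R * R -> R) (g : side -> R -> R).
Variables (ddf : 'I_2 -> 'I_2 -> R * R -> R) (G : 'I_2 -> side -> R -> R).
Hypotheses (ij : i != j) (af : approximable L f df g).
Hypothesis adf : forall a, approximable L (df a) (ddf a) (G a).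
Hypothesis g0 : forall s, s = upper_side j \/ s = lower_side j ->
  {ae leb1, forall t, side_dom L s t -> g s t = 0}.

(* Both sides are computed from the integral of [f] against d_i d_j psi,
   integrating by parts in either order. *)
Lemma boundary_test psi : C2 psi ->
  (forall s t, s = upper_side i \/ s = lower_side i -> side_values L psi s t = 0) ->
  boundary L j (fun s t => side_values L psi s t * G i s t) =
  << psi, ddf i j >> - << psi, ddf j i >>.
Proof.
move=> cp p0.
have [_ _ g2 _] := af; have [_ _ G2 _] := adf j.
have mtest q s : C1 q -> measurable_fun (side_dom L s) (side_values L q s).
  move=> cq; apply: measurable_funTS; apply: continuous_measurable_fun.
  exact: side_values_continuous (C1_continuous cq).
have mg s : measurable_fun (side_dom L s) (g s).
  exact: @inL2_measurable _ _ _ leb1 _ (measurable_side_dom L s) _ (g2 s).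
have mG s : measurable_fun (side_dom L s) (G j s).
  exact: @inL2_measurable _ _ _ leb1 _ (measurable_side_dom L s) _ (G2 s).
have E1 := parts_test L_gt0 j cp.1 (adf i).
have E2 := parts_test L_gt0 i (cp.2 j) af.
have E3 := parts_test L_gt0 j (cp.2 i) af.
have E4 := parts_test L_gt0 i cp.1 (adf j).
(* Three of the four boundary terms vanish: on the sides orthogonal to the [i]-th axis psi is 0
   together with its tangential derivative, and on those orthogonal to the [j]-th axis [g] is 0. *)
have Z2 : boundary L i (fun s t => side_values L (pderiv j psi) s t * g s t) = 0.
  apply: boundary_eq0 => s; first exact: measurable_funM (mtest _ _ (cp.2 j)) (mg s).
  by move=> sE; apply: aeW => t _; rewrite (pderiv_side cp.1 ij sE (p0 s ^~ sE)) mul0r.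
have Z3 : boundary L j (fun s t => side_values L (pderiv i psi) s t * g s t) = 0.
  apply: boundary_eq0 => s; first exact: measurable_funM (mtest _ _ (cp.2 i)) (mg s).
  move=> /g0; apply: filterS; first exact: (ae_filter_ringOfSetsType leb1).
  by move=> t /[apply] ->; rewrite mulr0.
have Z4 : boundary L i (fun s t => side_values L psi s t * G j s t) = 0.
  apply: boundary_eq0 => s; first exact: measurable_funM (mtest _ _ cp.1) (mG s).
  by move=> sE; apply: aeW => t _; rewrite p0// mul0r.
rewrite Z2 in E2; rewrite Z3 in E3; rewrite Z4 in E4.
(* With the mixed derivatives of psi identified, [E2], [E3] and [E4] chain: the pairing of d_j psi
   with [df i] equals that of d_i psi with [df j], which is minus that of psi with [ddf j i]. *)
rewrite (pderivC _ _ cp) in E2.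
rewrite -E1 -(addr0_eq E2) -(addr0_eq E4) -(addr0_eq E3).
by rewrite opprK addrC.
Qed.

(* The two mixed derivatives of [f] come from unrelated approximations of
   [df i] and [df j]. If [psi] vanishes on all sides they agree by
   [boundary_test]; cutoffs in direction [j] give the general case. *)
Lemma mixed_test psi : C2 psi ->
  (forall s t, s = upper_side i \/ s = lower_side i -> side_values L psi s t = 0) ->
  << psi, ddf i j >> = << psi, ddf j i >>.
Proof.
move=> cp p0.
have mO := measurable_Omega L.
have p2 := inL2_continuous L (C1_continuous cp.1).
have [_ ddf2i _ _] := adf i; have [_ ddf2j _ _] := adf j.
have mc n : measurable_fun (Omega L) (cutoff j n).
  by apply: measurable_funTS; apply: continuous_measurable2;
    exact: C1_continuous (C2_cutoff j n).1.
have c1 n p : Omega L p -> `|cutoff j n p| <= 1 by move=> /(rescaled_lt1 j)/cutoff_le1.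
have cc p : Omega L p -> (cutoff j)^~ p @ \oo -->
  (1 : R) by move=> /(rescaled_lt1 j)/cutoff_cvg.
have lim1 := cvg_Rintegral_cutoff mO (inL2_mul_integrable mO p2 (ddf2i j)) mc c1 cc.
have lim2 := cvg_Rintegral_cutoff mO (inL2_mul_integrable mO p2 (ddf2j i)) mc c1 cc.
apply: cvg_unique lim2 => //; apply: cvg_trans lim1; apply: near_eq_cvg;
  apply: nearW => n.
(* [boundary_test] applies to this product, and its boundary term is 0 because the cutoff vanishes
   on the sides orthogonal to the [j]-th axis. *)
have c0 : C2 (fun p => cutoff j n p * psi p) := C2M (C2_cutoff j n) cp.
have v0 s t : s = upper_side i \/ s = lower_side i ->
  side_values L (fun p => cutoff j n p * psi p) s t = 0.
  by move=> sE; move: (p0 s t sE); rewrite /side_values => ->; rewrite mulr0.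
have := boundary_test c0 v0.
rewrite (_ : boundary _ _ _ = 0).
  move=> /esym/eqP; rewrite subr_eq0 => /eqP E.
  have A f' : << cutoff j n, (fun p => psi p * f' p) >> =
    << (fun p => cutoff j n p * psi p), f' >>.
    by apply: eq_Rintegral => p _; rewrite mulrA.
  exact: etrans (A _) (etrans E (esym (A _))).
rewrite -[RHS](boundary0 j) /boundary; congr (_ - _); apply: eq_Rintegral => t _.
  have := @cutoff_side j n _ t (or_introl (erefl (upper_side j))).
  by rewrite /side_values => ->; rewrite !mul0r.
have := @cutoff_side j n _ t (or_intror (erefl (lower_side j))).
by rewrite /side_values => ->; rewrite !mul0r.
Qed.

(* The trace [G i] of the tangential derivative of [f] vanishes on the sides
   where [f] does, stated weakly. *)
Lemma boundary_tangential h dh e : approximable L h dh e ->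
  boundary L j (fun s t => e s t * G i s t) = 0.
Proof.
move=> [h2 dh2 e2 [H cH [H0 H1 H2]]].
have [_ _ G2 _] := adf i.
have eH n s : inL2 leb1 (side_dom L s) (side_values L (H n) s).
  exact: inL2_continuous_side (side_values_continuous (C1_continuous (cH n).1)).
(* The trace [e] is the L^2 limit of the boundary values of [H n], so it may be replaced by them. *)
suff Hn n : boundary L j (fun s t => side_values L (H n) s t * G i s t) = 0.
  have : (fun n => boundary L j (fun s t => side_values L (H n) s t * G i s t)) @ \oo -->
      boundary L j (fun s t => e s t * G i s t).
    apply: cvg_boundary => //.
    by move=> s; under eq_fun do rewrite L2norm_subrr; exact: cvg_cst.
  by under eq_fun do rewrite Hn; move/(cvg_lim (@Rhausdorff R)); rewrite lim_cst.
have lims s : s = upper_side j \/ s = lower_side j ->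
    (fun m => \int[leb1]_(t in side_dom L s)
      (side_values L (cutoff i m) s t * (side_values L (H n) s t * G i s t)))
    @ \oo --> \int[leb1]_(t in side_dom L s) (side_values L (H n) s t * G i s t).
  move=> sE; apply: (@cvg_Rintegral_cutoff _ _ _ leb1 _ (measurable_side_dom L s)
    (fun t => side_values L (H n) s t * G i s t) (fun m => side_values L (cutoff i m) s)).
  - exact: (@inL2_mul_integrable _ _ _ leb1 _ (measurable_side_dom L s) _ _ (eH n s)
      (G2 s)).
  - move=> m; apply: measurable_funTS; apply: continuous_measurable_fun.
    exact: side_values_continuous (C1_continuous (C2_cutoff i m).1).
  - by move=> m t /(rescaled_side ij sE)/cutoff_le1; exact.
  - by move=> t /(rescaled_side ij sE)/cutoff_cvg; exact.
have Hl : (fun m => boundary L j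
  (fun s t => side_values L (cutoff i m) s t * (side_values L (H n) s t * G i s t)))
    @ \oo --> boundary L j (fun s t => side_values L (H n) s t * G i s t).
  exact: cvgB (lims _ (or_introl (erefl (upper_side j))))
    (lims _ (or_intror (erefl (lower_side j)))).
(* The cutoff in direction [i] makes the test function vanish on the sides orthogonal to the [i]-th
   axis; then [boundary_test] expresses the boundary term as a difference that is 0 by
   [mixed_test]. *)
suff E0 : (fun m => boundary L j
  (fun s t => side_values L (cutoff i m) s t * (side_values L (H n) s t * G i s t)))
    = fun=> 0.
  by rewrite E0 in Hl; rewrite -(cvg_lim (@Rhausdorff R) Hl) lim_cst.
apply/funext => m.
have c0 : C2 (fun p => cutoff i m p * H n p) := C2M (C2_cutoff i m) (cH n).
have v0 s t : s = upper_side i \/ s = lower_side i ->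
  side_values L (fun p => cutoff i m p * H n p) s t = 0.
  by move=> /(@cutoff_side i m s t); rewrite /side_values => ->; rewrite mul0r.
have := boundary_test c0 v0; rewrite (mixed_test c0 v0) subrr => <-.
by rewrite /boundary; congr (_ - _); apply: eq_Rintegral => t _; rewrite mulrA.
Qed.

End VanishingTrace.

End Tangential.

(** * The Poincare inequality *)

Section Primitive.
Context {R : realType}.

(* Only what happens to the right of [a] matters, so [theta] is first cut off
   on the left to make it integrable near -oo. *)
Lemma primitive_right (a : R) (theta : R -> R) : continuous theta ->
  exists phi theta' : R -> R,
    [/\ continuous theta', (forall x, a <= x -> theta' x = theta x) &
        forall x : R, is_derive x (1 : R) phi (theta' x)].
Proof.
move=> ct.
(* A continuous ramp, 0 to the left of a - 1 and 1 to the right of a. *)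
pose k (x : R) := Num.min 1 (Num.max 0 (x - a + 1)).
pose th (x : R) := k x * theta x.
have ck : continuous k.
  have cl : continuous (fun x : R => x - a + 1).
    by move=> x; apply: cvgD;
      [apply: cvgB; [exact: cvg_id|exact: cvg_cst]|exact: cvg_cst].
  move=> x; apply: (@continuous_min _ _ (cst 1) (cst 0 \max (fun x => x - a + 1))).
    exact: cvg_cst.
  by apply: continuous_max; [exact: cvg_cst|exact: cl].
have cth : continuous th by move=> x; exact: (cvgM (ck x) (ct x)).
have th0 x : x < a - 1 -> th x = 0.
  move=> xa; have xa' : x - a + 1 <= 0 by lra.
  by rewrite /th /k (max_l xa') (min_r ler01) mul0r.
have thE x : a <= x -> th x = theta x.
  move=> ax; have xa0 : 0 <= x - a + 1 by lra.
  have xa1 : 1 <= x - a + 1 by lra.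
  by rewrite /th /k (max_r xa0) (min_l xa1) mul1r.
exists (fun x => \int[leb1]_(t in `]-oo, x]) th t), th; split; [exact: cth|exact: thE|].
have Ith u : leb1.-integrable `]-oo, u] (EFin \o th).
  have mI : measurable (`]-oo, u]%classic : set (measurableTypeR R)) := measurable_itv _.
  have mJ : measurable (`[a - 1, u]%classic : set (measurableTypeR R)) :=
    measurable_itv _.
  apply/(integrable_mkcond _ mI).2.
  rewrite (_ : _ \_ _ = (EFin \o th) \_ `[a - 1, u]).
    apply/(integrable_mkcond _ mJ).1.
    by apply: continuous_compact_integrable;
      [exact: segment_compact|exact: continuous_subspaceT].
  apply/funext => x; rewrite !patchE !mem_setE !in_itv/=.
  have [xa|//] := ltP x (a - 1).
  by rewrite /= th0//; case: ifP.
move=> x; have xu : x < x + 1 by rewrite ltrDl.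
have [d1 d2] := continuous_FTC1 xu (Ith (x + 1)) (ltNyr x) (cth x).
by apply: (DeriveDef d1); rewrite -derive1E; exact: d2.
Qed.

End Primitive.

Section Poincare.
Context {R : realType}.
Variable L : R.
Hypothesis L_gt0 : 0 < L.
Local Notation "'<<' f , h '>>'" := (\int[leb2]_(p in Omega L) (f p * h p)).
Local Notation norm2 := (L2norm leb2 (Omega L)).

(* (1 - y) w^2 vanishes on both horizontal sides, so its y-derivative has
   integral 0. *)
Lemma L2norm_from_bottom (w : R * R -> R) : C1 w -> (forall x, w (x, 0) = 0) ->
  norm2 w <= 2 * norm2 (pderiv 1 w).
Proof.
move=> cw w0.
pose psi (p : R * R) : R := 1 + (-1) * p.2.
have c2 : C2 (fun p : R * R => (-1) * p.2) := C2M (C2_cst (-1)) C2_snd.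
have cp : C2 psi := C2D (C2_cst 1) c2.
have dp p : pderiv 1 psi p = -1.
  have lin : linear (snd : R * R -> R) by [].
  have csnd : continuous (snd : R * R -> R) by move=> q; exact: cvg_snd.
  rewrite /psi (pderivD 1 (C1_cst 1) c2.1) (pderivM 1 (C1_cst (-1)) C2_snd.1) !pderiv_cst.
  by rewrite (pderiv_linear 1 lin csnd) /evec/= add0r mul0r addr0 mulr1.
have mO := measurable_Omega L.
have w2 := inL2_continuous L (C1_continuous cw).
have dw2 := inL2_continuous L (cw.2 1).
have psi1 p : Omega L p -> `|psi p| <= 1.
  move=> [_ /andP[a b]]; rewrite /psi ler_norml; apply/andP; split; lra.
have mpsi : measurable_fun (Omega L) psi.
  by apply: measurable_funTS; apply: continuous_measurable2; exact: C1_continuous cp.1.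
have pw2 : inL2 leb2 (Omega L) (fun p => psi p * w p) := inL2_mulb mO mpsi psi1 w2.
have := Green_weighted L_gt0 1 cp.1 cw cw.
have -> : boundary L 1
  (fun s t => side_values L psi s t * side_values L w s t * side_values L w s t) = 0.
  rewrite -[RHS](boundary0 L 1) /boundary; congr (_ - _); apply: eq_Rintegral => t _.
    by rewrite /side_values /psi/= mulr1 subrr !mul0r.
  by rewrite /side_values /= w0 mulr0.
have -> : << (fun p => pderiv 1 psi p * w p), w >> = - << w, w >>.
  rewrite -mulN1r -RintegralZl//; last exact: inL2_mul_integrable.
  by apply: eq_Rintegral => p _; rewrite dp mulrA.
have -> : << (fun p => psi p * pderiv 1 w p), w >> =
  << (fun p => psi p * w p), pderiv 1 w >>.
  by apply: eq_Rintegral => p _; rewrite mulrAC.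
move=> E.
(* The product rule yields the cross term twice; since 0 <= psi <= 1 on the rectangle, this doubling
   is where the factor 2 of the estimate comes from. *)
have ww : norm2 w ^+ 2 = << (fun p => psi p * w p), pderiv 1 w >> *+ 2.
  rewrite L2norm_sqr// mulr2n; move: E.
  set W := (X in - X + _ + _ = _); set Z := (X in - _ + X + _ = _).
  by move=> E; apply/eqP; rewrite -subr_eq0 -opprB oppr_eq0 addrC addrA; apply/eqP.
have le : norm2 w * norm2 w <= 2 * norm2 (pderiv 1 w) * norm2 w.
  rewrite -expr2 ww -[leLHS]mulr_natl -[leRHS]mulrA ler_wpM2l//.
  apply: le_trans (ler_norm _) _; apply: le_trans (L2_CauchySchwarz mO pw2 dw2) _.
  rewrite mulrC ler_wpM2l ?L2norm_ge0//.
  by apply: le_trans (L2norm_mulb mO ler01 mpsi psi1 w2) _; rewrite mul1r.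
have := L2norm_ge0 leb2 (Omega L) w; rewrite le_eqVlt => /predU1P[<-|w_gt0].
  by rewrite mulr_ge0// L2norm_ge0.
by move: le; rewrite ler_pM2r.
Qed.

(** * Divergence-free fields tangential to the boundary *)

Section DivergenceFree.
Variables (f h : R * R -> R) (df dh : 'I_2 -> R * R -> R) (g e : side -> R -> R).
Hypotheses (af : approximable L f df g) (ah : approximable L h dh e).
Hypothesis div0 : {ae leb2, forall p, Omega L p -> df 0 p + dh 1 p = 0}.
Hypothesis g0 : forall s, s = upper_side 0 \/ s = lower_side 0 ->
  {ae leb1, forall t, side_dom L s t -> g s t = 0}.
Hypothesis e0 : forall s, s = upper_side 1 \/ s = lower_side 1 ->
  {ae leb1, forall t, side_dom L s t -> e s t = 0}.

(** Weak form of the fact that the field (f, h) has no flux through vertical segments. The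
    divergence is tested against a primitive phi(x) of theta: all boundary terms vanish by the
    conditions on the traces, and the term in h vanishes because phi does not depend on y. *)
Lemma zero_flux (theta : R -> R) : continuous theta -> << (fun p => theta p.1), f >> = 0.
Proof.
move=> ct; have [phi [th [cth thE dphi]]] := primitive_right (- L) ct.
have cp := C1_fst_comp dphi cth.
have [d0 d1] := pderiv_fst_comp dphi.
have mO := measurable_Omega L.
have [f2 df2 g2 _] := af; have [h2 dh2 e2 _] := ah.
have p2 := inL2_continuous L (C1_continuous cp).
have mp s : measurable_fun (side_dom L s) (side_values L (fun p => phi p.1) s).
  apply: measurable_funTS; apply: continuous_measurable_fun.
  exact: side_values_continuous (C1_continuous cp).
have mg s : measurable_fun (side_dom L s) (g s).
  exact: @inL2_measurable _ _ _ leb1 _ (measurable_side_dom L s) _ (g2 s).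
have me s : measurable_fun (side_dom L s) (e s).
  exact: @inL2_measurable _ _ _ leb1 _ (measurable_side_dom L s) _ (e2 s).
have := parts_test L_gt0 0 cp af; have := parts_test L_gt0 1 cp ah.
rewrite [X in _ = X -> _]boundary_eq0; last 2 first.
- by move=> s; exact: measurable_funM.
- move=> s /e0; apply: filterS; first exact: (ae_filter_ringOfSetsType leb1).
  by move=> t /[apply] ->; rewrite mulr0.
rewrite [X in _ -> _ = X -> _]boundary_eq0; last 2 first.
- by move=> s; exact: measurable_funM.
- move=> s /g0; apply: filterS; first exact: (ae_filter_ringOfSetsType leb1).
  by move=> t /[apply] ->; rewrite mulr0.
rewrite d0 d1.
under eq_Rintegral do rewrite mul0r.
rewrite (_ : \int[_]_(_ in _) 0 = 0) ?add0r; last by rewrite /Rintegral integral0.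
(* The cut-off [th] agrees with theta for x >= - L, hence on the whole rectangle. *)
have -> : << (fun p => th p.1), f >> = << (fun p => theta p.1), f >>.
  apply: eq_Rintegral => p; rewrite inE => -[/andP[/ltW a _] _].
  by rewrite thE.
move=> E1 E2.
have : << (fun p => phi p.1), df 0 >> + << (fun p => phi p.1), dh 1 >> = 0.
  rewrite -RintegralD//; [|exact: inL2_mul_integrable..].
  rewrite /Rintegral (_ : (\int[_]_(_ in _) _)%E = 0%E)//.
  have msum : measurable_fun (Omega L) (fun p => phi p.1 * df 0 p + phi p.1 * dh 1 p).
    apply: measurable_funD; apply: measurable_funM;
      apply: (@inL2_measurable _ _ _ leb2 _ mO);
      by [exact: p2|exact: df2|exact: dh2].
  rewrite -[RHS](integral0 leb2 (Omega L)); apply: ae_eq_integral => //.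
  - exact/measurable_EFinP.
  - apply: (@filterS _ _ (ae_filter_ringOfSetsType leb2) _ _ _ div0) => p /[apply] E.
    by rewrite /= -mulrDr E mulr0.
by rewrite E1 addr0 => E3; rewrite E3 addr0 in E2.
Qed.

(** Obtained as the limit of the pairings of [F n] with f. By [zero_flux], [F n] may be replaced
    there by w = F n(x, y) - F n(x, 0), which vanishes on the bottom side and has the same
    y-derivative, so that [L2norm_from_bottom] applies. *)
Lemma Poincare_flux : norm2 f ^+ 2 <= 2 * norm2 (df 1) * norm2 f.
Proof.
have [f2 df2 g2 [F cF [F0 F1 F2]]] := af.
have mO := measurable_Omega L.
have kF n := C1_continuous (cF n).1.
have F2' n := inL2_continuous L (kF n).
have dF2 n := inL2_continuous L ((cF n).1.2 1).
have lim1 : (fun n => << F n, f >>) @ \oo --> norm2 f ^+ 2.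
  rewrite L2norm_sqr//; apply: cvg_ip => //.
  by under eq_fun do rewrite L2norm_subrr; exact: cvg_cst.
have lim2 : (fun n => 2 * norm2 (pderiv 1 (F n)) * norm2 f) @ \oo -->
  2 * norm2 (df 1) * norm2 f.
  by apply: cvgMr_tmp; apply: cvgMl_tmp; apply: cvg_L2norm => //; exact: F1.
apply: ler_cvg_to lim1 lim2 _; apply: nearW => n.
pose th x := F n (x, 0).
have cth : continuous th := continuous_section_fst (kF n).
have dth x := is_derive_fst ((cF n).1.1 (x, 0)).
have cdth : continuous (fun x => pderiv 0 (F n) (x, 0)) :=
  continuous_section_fst ((cF n).1.2 0).
have c1 := C1_fst_comp dth cdth.
have [_ d1] := pderiv_fst_comp dth.
pose w p := F n p + (-1) * th p.1.
have c1' : C1 (fun p : R * R => (-1) * th p.1) := C1M (C1_cst (-1)) c1.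
have cw : C1 w := C1D (cF n).1 c1'.
have dw : pderiv 1 w = pderiv 1 (F n).
  rewrite /w (pderivD 1 (cF n).1 c1') (pderivM 1 (C1_cst (-1)) c1) pderiv_cst d1.
  by apply/funext => p; rewrite mulr0 mul0r !addr0.
have w2 := inL2_continuous L (C1_continuous cw).
have -> : << F n, f >> = << w, f >>.
  have th2 := inL2_continuous L (C1_continuous c1).
  rewrite -[LHS]subr0 -[X in _ - X](zero_flux cth) -RintegralB_ip//.
  by apply: eq_Rintegral => p _; rewrite /w mulN1r.
apply: le_trans (ler_norm _) _; apply: le_trans (L2_CauchySchwarz mO w2 f2) _.
rewrite ler_wpM2r ?L2norm_ge0// -dw; apply: L2norm_from_bottom => // x.
by rewrite /w /th/= mulN1r subrr.
Qed.

End DivergenceFree.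
End Poincare.

(** * The gradient estimate *)

Section Estimate.
Context {R : realType}.
Implicit Types (L : R) (u : 'I_2 -> R * R -> R).

Local Notation "'<<' L , f , h '>>'" := (\int[leb2]_(p in Omega L) (f p * h p)).

Lemma sum2 (F : 'I_2 -> R) : \sum_(i < 2) F i = F 0 + F 1.
Proof.
by rewrite !big_ord_recl big_ord0 addr0; congr (F _ + F _); exact/val_inj.
Qed.

Lemma dot2 (a b : 'I_2 -> R) : dot a b = a 0 * b 0 + a 1 * b 1.
Proof. by rewrite /dot sum2. Qed.

(** On the vertical sides the slip coefficient is 0, and the left-hand side reduces to mu (G 1 0 + G
    0 1). *)
Lemma slip_vertical (mu k0 k1 : R) (G : 'I_2 -> 'I_2 -> R) (g : 'I_2 -> R) s :
  0 < mu -> s = upper_side 0 \/ s = lower_side 0 ->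
  2 * mu * dot (fun i => dot (symgrad G i) (normal s)) (tangent s) =
    slip k0 k1 s * dot g (tangent s) ->
  G 1 0 = - G 0 1.
Proof.
move=> mu0 [|] ->; rewrite !dot2 /symgrad /normal /tangent /slip /vec2/= => E.
  have : mu * (G 1 0 + G 0 1) = 0 by lra.
  by move/eqP; rewrite mulf_eq0 gt_eqF//= addr_eq0 => /eqP.
have : mu * (G 1 0 + G 0 1) = 0 by lra.
by move/eqP; rewrite mulf_eq0 gt_eqF//= addr_eq0 => /eqP.
Qed.

(* [k1 / mu] on the top side and [- k0 / mu] on the bottom one: the slip
   coefficient divided by [mu], up to the sign of the second component of the
   normal, which is part of [boundary]. *)
Definition slip_weight (mu k0 k1 : R) (p : R * R) : R :=
  - (k0 / mu) + (k0 / mu + k1 / mu) * p.2.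

(** The slip condition reads mu (G 0 1 + G 1 0) = k1 g 0 on the top side and - k0 g 0 on the bottom
    one. The parameter [t] is arbitrary, since the weight is constant on each of the two. *)
Lemma slip_horizontal (mu k0 k1 L : R) (G : 'I_2 -> 'I_2 -> R) (g : 'I_2 -> R) s t :
  0 < mu -> s = upper_side 1 \/ s = lower_side 1 ->
  2 * mu * dot (fun i => dot (symgrad G i) (normal s)) (tangent s) =
    slip k0 k1 s * dot g (tangent s) ->
  G 0 1 = side_values L (slip_weight mu k0 k1) s t * g 0 - G 1 0.
Proof.
move=> mu0 [|] ->; rewrite !dot2 /side_values /slip_weight /symgrad /normal /tangent /slip
  /vec2/= => E.
  have {}E : mu * (G 0 1 + G 1 0) = k1 * g 0 by lra.
  apply: (mulfI (lt0r_neq0 mu0)); rewrite mulrBr; apply/eqP;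
    rewrite eq_sym subr_eq -mulrDr E.
  by apply/eqP; field; rewrite gt_eqF.
have {}E : mu * (G 0 1 + G 1 0) = - k0 * g 0 by lra.
apply: (mulfI (lt0r_neq0 mu0)); rewrite mulrBr; apply/eqP;
  rewrite eq_sym subr_eq -mulrDr E.
by apply/eqP; field; rewrite gt_eqF.
Qed.

Lemma slip_weight_C1 (mu k0 k1 : R) : C1 (slip_weight mu k0 k1) /\
  forall p, pderiv 1 (slip_weight mu k0 k1) p = k0 / mu + k1 / mu.
Proof.
set b := k0 / mu + k1 / mu.
have cb : C1 (fun p : R * R => b * p.2) := C1M (C1_cst b) C2_snd.1.
split; first exact: C1D (C1_cst _) cb.
move=> p.
have lin : linear (snd : R * R -> R) by [].
have csnd : continuous (snd : R * R -> R) by move=> q; exact: cvg_snd.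
rewrite /slip_weight (pderivD 1 (C1_cst _) cb) (pderivM 1 (C1_cst _) C2_snd.1)
  !pderiv_cst.
by rewrite (pderiv_linear 1 lin csnd) /evec/= add0r mul0r addr0 mulr1.
Qed.

Lemma slip_weight_bound (mu k0 k1 L : R) p : Omega L p ->
  `|slip_weight mu k0 k1 p| <= `|k0 / mu| + `|k1 / mu|.
Proof.
move=> [_ /andP[y0 y1]]; rewrite /slip_weight.
set a := k0 / mu; set b := k1 / mu.
have -> : - a + (a + b) * p.2 = b * p.2 - a * (1 - p.2) by ring.
apply: le_trans (ler_normB _ _) _; rewrite [leRHS]addrC.
apply: lerD; rewrite (normrM _ (_ : R)).
  by rewrite ler_piMr// ger0_norm// ltW.
by rewrite ler_piMr// ger0_norm ?subr_ge0; lra.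
Qed.

(** * Estimate of the boundary term left by the slip condition *)

Section Boundary.
Variables (L mu k0 k1 : R).
Hypotheses (L_gt0 : 0 < L).
Local Notation norm2 := (L2norm leb2 (Omega L)).
Variables (f : R * R -> R) (df : 'I_2 -> R * R -> R) (g : side -> R -> R).
Hypothesis af : approximable L f df g.
Hypothesis poincare : norm2 f ^+ 2 <= 2 * norm2 (df 1) * norm2 f.

(** Integration by parts in y of weight * f^2 gives (k0 / mu + k1 / mu) |f|^2 plus twice the pairing
    of weight * f with d_y f. With M the bound on the weight, the first term is at most 2 M |f| |d_y
    f| by [poincare] and the second likewise by Cauchy-Schwarz, whence the factor 4. *)
Lemma boundary_estimate :
  boundary L 1 (fun s t => side_values L (slip_weight mu k0 k1) s t * g s t * g s t) <=
  4 * (`|k0 / mu| + `|k1 / mu|) * (norm2 f * norm2 (df 1)).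
Proof.
have [f2 df2 g2 _] := af.
have [cw dw] := slip_weight_C1 mu k0 k1.
have mO := measurable_Omega L.
set M := `|k0 / mu| + `|k1 / mu|.
have M0 : 0 <= M by rewrite addr_ge0.
have wM p : Omega L p -> `|slip_weight mu k0 k1 p| <= M by exact: slip_weight_bound.
have mw : measurable_fun (Omega L) (slip_weight mu k0 k1).
  by apply: measurable_funTS; apply: continuous_measurable2; exact: C1_continuous.
have wf2 : inL2 leb2 (Omega L) (fun p => slip_weight mu k0 k1 p * f p).
  exact: (inL2_mulb mO mw wM).
rewrite -(parts_weighted L_gt0 1 cw af af).
have -> : << L, (fun p => pderiv 1 (slip_weight mu k0 k1) p * f p), f >> =
    (k0 / mu + k1 / mu) * norm2 f ^+ 2.
  rewrite L2norm_sqr// -RintegralZl//; last exact: inL2_mul_integrable.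
  by apply: eq_Rintegral => p _; rewrite dw mulrA.
have -> : << L, (fun p => slip_weight mu k0 k1 p * df 1 p), f >> =
    << L, (fun p => slip_weight mu k0 k1 p * f p), df 1 >>.
  by apply: eq_Rintegral => p _; rewrite mulrAC.
have cs : << L, (fun p => slip_weight mu k0 k1 p * f p), df 1 >> <=
  M * (norm2 f * norm2 (df 1)).
  apply: le_trans (ler_norm _) _; apply: le_trans (L2_CauchySchwarz mO wf2 (df2 1)) _.
  by rewrite mulrA ler_wpM2r ?L2norm_ge0//; exact: L2norm_mulb.
have q : (k0 / mu + k1 / mu) * norm2 f ^+ 2 <= M * (2 * norm2 (df 1) * norm2 f).
  apply: le_trans (_ : M * norm2 f ^+ 2 <= _); last exact: ler_wpM2l.
  by rewrite ler_wpM2r ?sqr_ge0// (le_trans (ler_norm _))// ler_normD.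
lra.
Qed.
End Boundary.

(** * The estimate for a field with given gradient, second derivatives and traces *)

Section MainEstimate.
Variables (mu k0 k1 L : R) (u : 'I_2 -> R * R -> R).
Hypothesis L_gt0 : 0 < L.
Local Notation norm2 := (L2norm leb2 (Omega L)).
(** Membership in V and the slip condition each supply their own traces of u. They are kept apart:
    [gV] has vanishing normal component, [g] satisfies the slip relation, and each integration by
    parts uses whichever it needs. *)
Variables (gV g : 'I_2 -> side -> R -> R) (G : 'I_2 -> 'I_2 -> side -> R -> R).
Variables (d : 'I_2 -> 'I_2 -> R * R -> R) (dd : 'I_2 -> 'I_2 -> 'I_2 -> R * R -> R).
Hypotheses (aV : forall i, approximable L (u i) (d i) (gV i)).
Hypotheses (ag : forall i, approximable L (u i) (d i) (g i)).
Hypotheses (aG : forall i j, approximable L (d i j) (dd i j) (G i j)).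
Hypothesis div0 : {ae leb2, forall p, Omega L p -> d 0 0 p + d 1 1 p = 0}.
Hypothesis gV0 : forall j s, s = upper_side j \/ s = lower_side j ->
  {ae leb1, forall t, side_dom L s t -> gV j s t = 0}.
Hypothesis slipv : forall s, s = upper_side 0 \/ s = lower_side 0 ->
  {ae leb1, forall t, side_dom L s t -> G 1 0 s t = - G 0 1 s t}.
Hypothesis sliph : forall s, s = upper_side 1 \/ s = lower_side 1 ->
  {ae leb1, forall t, side_dom L s t ->
     G 0 1 s t = side_values L (slip_weight mu k0 k1) s t * g 0 s t - G 1 0 s t}.

(** Integration by parts of u_i against d_j u_i, with Cauchy-Schwarz for the term in d_j d_j u_i. *)
Lemma norm2_grad i j (e : side -> R -> R) : approximable L (u i) (d i) e ->
  norm2 (d i j) ^+ 2 <=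
  boundary L j (fun s t => e s t * G i j s t) + norm2 (u i) * norm2 (dd i j j).
Proof.
move=> ae; have [u2 d2 _ _] := ae; have [_ dd2 _ _] := aG i j.
have mO := measurable_Omega L.
rewrite L2norm_sqr// -(parts L_gt0 j ae (aG i j)) -addrA lerDl.
have := L2_CauchySchwarz mO u2 (dd2 j).
by rewrite ler_norml => /andP[+ _]; rewrite -subr_ge0 opprK addrC.
Qed.

Let mG i j s : measurable_fun (side_dom L s) (G i j s).
Proof. by have [_ _ G2 _] := aG i j;
  exact: @inL2_measurable _ _ _ leb1 _ (measurable_side_dom L s) _ (G2 s). Qed.

Let mgV i s : measurable_fun (side_dom L s) (gV i s).
Proof. by have [_ _ G2 _] := aV i;
  exact: @inL2_measurable _ _ _ leb1 _ (measurable_side_dom L s) _ (G2 s). Qed.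

Let mg i s : measurable_fun (side_dom L s) (g i s).
Proof. by have [_ _ G2 _] := ag i;
  exact: @inL2_measurable _ _ _ leb1 _ (measurable_side_dom L s) _ (G2 s). Qed.

Lemma boundary_normal i : boundary L i (fun s t => gV i s t * G i i s t) = 0.
Proof.
apply: boundary_eq0 => s; first exact: measurable_funM.
move=> /gV0; apply: filterS; first exact: (ae_filter_ringOfSetsType leb1).
by move=> t /[apply] ->; rewrite mul0r.
Qed.

(** On the vertical sides slip turns d_x u_1 into - d_y u_0, the tangential derivative of u_0 up to
    sign, and u_0 vanishes there. *)
Lemma boundary_vertical : boundary L 0 (fun s t => gV 1 s t * G 1 0 s t) = 0.
Proof.
have T := boundary_tangential L_gt0 (isT : (1 : 'I_2) != 0) (aV 0) (aG 0) (gV0 (j := 0))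
  (aV 1).
rewrite (@boundary_ae_eq _ _ _ _ (fun s t => 0 - gV 1 s t * G 0 1 s t)).
- have [_ _ e2 _] := aV 1; have [_ _ G2 _] := aG 0 1.
  rewrite boundaryB ?T ?boundary0 ?subr0// => s; first exact: integrable0.
  exact: (inL2_mul_integrable (measurable_side_dom L s)).
- by move=> s; exact: measurable_funM.
- by move=> s; apply: measurable_funB => //; exact: measurable_funM.
- move=> s /slipv; apply: filterS; first exact: (ae_filter_ringOfSetsType leb1).
  by move=> t /[apply] ->; rewrite mulrN sub0r.
Qed.

(** Slip replaces d_y u_0 by weight * u_0 - d_x u_1; the last term is tangential on the horizontal
    sides, where u_1 vanishes, and so contributes nothing. *)
Lemma boundary_horizontal : boundary L 1 (fun s t => g 0 s t * G 0 1 s t) =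
  boundary L 1 (fun s t => side_values L (slip_weight mu k0 k1) s t * g 0 s t * g 0 s t).
Proof.
have T := boundary_tangential L_gt0 (isT : (0 : 'I_2) != 1) (aV 1) (aG 1) (gV0 (j := 1))
  (ag 0).
have [cw _] := slip_weight_C1 mu k0 k1.
have mw s : measurable_fun (side_dom L s) (side_values L (slip_weight mu k0 k1) s).
  apply: measurable_funTS; apply: continuous_measurable_fun.
  exact: side_values_continuous (C1_continuous cw).
rewrite (@boundary_ae_eq _ _ _ _
  (fun s t => side_values L (slip_weight mu k0 k1) s t * g 0 s t * g 0 s t
    - g 0 s t * G 1 0 s t)).
- have [_ _ g2 _] := ag 0; have [_ _ G2 _] := aG 1 0.
  rewrite boundaryB ?T ?subr0// => s; have mD := measurable_side_dom L s.
    have [M HM] := bounded_side L s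
      (side_values_continuous (s := s) (L := L) (C1_continuous cw)).
    by apply: (inL2_mul_integrable mD) => //; exact: (inL2_mulb mD (mw s) HM).
  exact: (inL2_mul_integrable mD).
- by move=> s; exact: measurable_funM.
- move=> s; apply: measurable_funB; last exact: measurable_funM.
  by apply: measurable_funM => //; exact: measurable_funM.
- move=> s /sliph; apply: filterS; first exact: (ae_filter_ringOfSetsType leb1).
  by move=> t /[apply] ->; rewrite mulrBr mulrC.
Qed.

(** Each of the four entries of the gradient contributes at most N H through its second derivative.
    Only d_y u_0 leaves a boundary term, which accounts for the rest of the constant. *)
Lemma gradient_estimate (N H : R) : (forall i, norm2 (u i) <= N) ->
  norm2 (d 0 1) <= H -> (forall i j, norm2 (dd i j j) <= H) ->
  \sum_(i < 2) \sum_(j < 2) norm2 (d i j) ^+ 2 <=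
    (4 + 4 * (`|k0 / mu| + `|k1 / mu|)) * N * H.
Proof.
move=> uN dH ddH.
have e00 := norm2_grad 0 (aV 0); have e01 := norm2_grad 1 (ag 0).
have e10 := norm2_grad 0 (aV 1); have e11 := norm2_grad 1 (aV 1).
rewrite !boundary_normal in e00 e11; rewrite boundary_vertical in e10;
  rewrite boundary_horizontal in e01.
have po := Poincare_flux L_gt0 (aV 0) (aV 1) div0 (gV0 (j := 0)) (gV0 (j := 1)).
have b := boundary_estimate mu k0 k1 L_gt0 (ag 0) po.
have n0 f := L2norm_ge0 leb2 (Omega L) f.
have pr (a c : R) : 0 <= a -> 0 <= c -> a <= N -> c <= H -> a * c <= N * H.
  by move=> a0 c0 aN cH; exact: ler_pM.
have p0 := pr _ _ (n0 (u 0)) (n0 (d 0 1)) (uN 0) dH.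
have p1 i j := pr _ _ (n0 (u i)) (n0 (dd i j j)) (uN i) (ddH i j).
have M0 : 0 <= 4 * (`|k0 / mu| + `|k1 / mu|) by rewrite mulr_ge0// addr_ge0.
have p2 := ler_wpM2l M0 p0.
have := p1 0 0; have := p1 0 1; have := p1 1 0; have := p1 1 1.
rewrite !sum2 -[X in _ -> _ -> _ -> _ -> _ <= X]mulrA mulrDl.
lra.
Qed.

End MainEstimate.

Lemma le_sqrt_sum (I : finType) (x : I -> R) i : x i <= Num.sqrt (\sum_k x k ^+ 2).
Proof.
apply: le_trans (ler_norm _) _; rewrite -sqrtr_sqr ler_sqrt; last first.
  by apply: sumr_ge0 => k _; exact: sqr_ge0.
by rewrite (bigD1 i)//= lerDl; apply: sumr_ge0 => k _; exact: sqr_ge0.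
Qed.

End Estimate.

Theorem lemma3p7 (R : realType) (mu k0 k1 : R) (mu_gt0 : 0 < mu) :
  exists C : R, 0 < C /\
    forall (L : R), 1 <= L ->
    forall u : 'I_2 -> R * R -> R, space_W mu k0 k1 L u ->
      grad_L2norm L u ^+ 2 <= C * vec_L2norm L u * grad_H1norm L u.
Proof.
(* The constant of [gradient_estimate], in which L does not occur. *)
exists (4 + 4 * (`|k0 / mu| + `|k1 / mu|)); split.
  by rewrite ltr_wpDr// mulr_ge0// addr_ge0.
move=> L L1 u [[H1u div [gV trV nV]] H2u [g [G [trg trG slipc]]]].
have L0 : 0 < L := lt_le_trans ltr01 L1.
have H1_le i j : H1norm L (wD L j (u i)) <= grad_H1norm L u.
  apply: le_trans (le_sqrt_sum (fun k => H1norm L (wD L k (u i))) j) _.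
  rewrite ler_sqrt; last by do 2![apply: sumr_ge0 => ? _]; exact: sqr_ge0.
  rewrite [leRHS](bigD1 i)//= lerDl; apply: sumr_ge0 => k _.
  by apply: sumr_ge0 => ? _; exact: sqr_ge0.
rewrite /grad_L2norm sqr_sqrtr; last by do 2![apply: sumr_ge0 => ? _]; exact: sqr_ge0.
apply: (@gradient_estimate _ _ _ _ _ _ L0 gV g G (fun i j => wD L j (u i))
  (fun i j k => wD L k (wD L j (u i)))).
- by move=> i; exact: trace_approximable.
- by move=> i; exact: trace_approximable.
- by move=> i j; exact: trace_approximable.
- apply: (@filterS _ _ (ae_filter_ringOfSetsType leb2) _ _ _ div) => p /[apply].
  by rewrite sum2.
- move=> j s sE; apply: (@filterS _ _ (ae_filter_ringOfSetsType leb1) _ _ _ (nV s)) => t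
    /[apply].
  rewrite dot2.
  (* On a side orthogonal to the [j]-th axis the normal component of the trace is its [j]-th
     component up to sign. *)
  have [j0|j0] := ord2_cases j.
    by rewrite j0 in sE *; case: sE => -> /=; rewrite /vec2/= => ?; lra.
  by rewrite j0 in sE *; case: sE => -> /=; rewrite /vec2/= => ?; lra.
- move=> s sE; apply: (@filterS _ _ (ae_filter_ringOfSetsType leb1) _ _ _ (slipc s)) => t
    /[apply].
  exact: (slip_vertical (G := fun a b => G a b s t)).
- move=> s sE; apply: (@filterS _ _ (ae_filter_ringOfSetsType leb1) _ _ _ (slipc s)) => t
    /[apply].
  exact: (slip_horizontal L (G := fun a b => G a b s t) (g := fun i => g i s t)).
- by move=> i; exact: le_sqrt_sum (fun i => L2norm leb2 (Omega L) (u i)) i.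
- apply: le_trans (H1_le 0 1); rewrite /H1norm.
  apply: le_trans (ler_norm _) _; rewrite -sqrtr_sqr ler_sqrt; last first.
    by rewrite addr_ge0 ?sqr_ge0//; apply: sumr_ge0 => ? _; exact: sqr_ge0.
  by rewrite lerDl; apply: sumr_ge0 => ? _; exact: sqr_ge0.
- move=> i j; apply: le_trans (H1_le i j); rewrite /H1norm.
  apply: le_trans (le_sqrt_sum (fun k => L2norm leb2 (Omega L) (wD L k (wD L j (u i)))) j)
    _.
  rewrite ler_sqrt; last by rewrite addr_ge0 ?sqr_ge0//; apply: sumr_ge0 => ? _;
    exact: sqr_ge0.
  by rewrite lerDr sqr_ge0.
Qed.
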